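(* The topological realization of the projective Fraïssé limit of the family $\mathcal{T}_{\mathcal{CE}}$ is homeomorphic to the Mohler-Nikiel universal dendroid.
   Context: Graphs are pairs $(V,E)$ with $E\subseteq V^2$ reflexive and symmetric; a topological graph has compact zero-dimensional second-countable vertex set and closed edge set. Trees: finite graphs with unique simple paths between distinct vertices; rooted trees have a root $r$ and order $x\le y$ iff the path from $r$ to $y$ contains $x$. Epimorphisms between rooted trees: vertex maps sending edges to edges, surjective on vertices and edges, root to root, order-preserving. Connected: not a union of two nonempty disjoint closed sets with no edges between. Confluent: for each connected $Q$ of the target every component $K$ of $f^{-1}(Q)$ has $f(K)=Q$; light: distinct vertices with the same image are never adjacent. Splitting edge map: replace an edge $\langle a,b\rangle$ ($a<b$) by $\langle a,x\rangle,\langle x,b\rangle$ with $x$ new, identity elsewhere, $x\mapsto a$ or $b$. Simple-confluent epimorphisms are finite compositions of splitting edge maps and light confluent epimorphisms. $\mathcal T_{\mathcal{CE}}$ is the projective Fraïssé family of rooted trees with at least two vertices and simple-confluent epimorphisms. Its projective Fraïssé limit is the unique rooted topological graph $\mathbb T$ that is an inverse limit $\varprojlim\{F_n,\alpha_n\}$ of members of the family with bonding maps in the family (edges coordinatewise) such that (i) every member is an image of $\mathbb T$ under an admissible epimorphism and (ii) for admissible $f\colon\mathbb T\to A$ and $g\colon B\to A$ in the family there is admissible $h\colon\mathbb T\to B$ with $f=g\circ h$, admissible meaning $h'\circ\alpha^\infty_m$ with $h'$ in the family. Its topological realization is the quotient $V(\mathbb T)/E(\mathbb T)$ (the edge relation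 being an equivalence relation). Mohler-Nikiel dendroid: let $d_1,d_2,\dots$ be a dense sequence in $[0,1)$ containing $0$ in which every value occurs infinitely often. Let $Y_0=[0,1]$; given $Y_n$ and maps $g_k$, let $Y_{n+1}$ be the disjoint union $Y_n\times\{0\}\cup Y_n\times\{1\}$ with $(y,0)$ and $(y,1)$ identified whenever $g^n_0(y)\le d_{n+1}$ (where $g^n_0=g_0\circ\dots\circ g_{n-1}\colon Y_n\to Y_0$, $g^0_0=\mathrm{id}$), and $g_n\colon Y_{n+1}\to Y_n$, $(y,j)\mapsto y$. The inverse limit $\varprojlim\{Y_n,g_n\}$ is the Mohler-Nikiel universal (smooth) dendroid; up to homeomorphism it does not depend on the choice of the sequence. *)

(* Defs.v *)
From HB Require Import structures.
From Stdlib Require Relation_Operators.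
From mathcomp Require Import all_boot all_order all_algebra generic_quotient.
From mathcomp Require Import all_classical all_reals.
From mathcomp Require Import topology_structure product_topology subtype_topology
  discrete_topology bool_topology quotient_topology num_topology function_spaces.

Set Implicit Arguments.
Unset Strict Implicit.
Unset Printing Implicit Defensive.

Import Order.TTheory GRing.Theory Num.Theory.
Import numFieldTopology.Exports.
Local Open Scope quotient_scope.

Definition homeomorphic (X Y : topologicalType) : Prop :=
  exists (f : X -> Y) (g : Y -> X),
    [/\ cancel f g, cancel g f, continuous f & continuous g].

(** The equivalence relation generated by a (Prop-valued) relation, as a
    boolean equivalence relation (needed by the library quotient). *)
Definition geq (T : Type) (r : T -> T -> Prop) : rel T :=
  fun x y => `[< Relation_Operators.clos_refl_sym_trans T r x y >].

Lemma geq_refl (T : Type) (r : T -> T -> Prop) : reflexive (geq r).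
Proof. by move=> x; apply/asboolP; apply: Relation_Operators.rst_refl. Qed.

Lemma geq_sym (T : Type) (r : T -> T -> Prop) : symmetric (geq r).
Proof.
move=> x y; apply/asboolP/asboolP; exact: Relation_Operators.rst_sym.
Qed.

Lemma geq_trans (T : Type) (r : T -> T -> Prop) : transitive (geq r).
Proof.
move=> y x z /asboolP Hxy /asboolP Hyz; apply/asboolP; exact: Relation_Operators.rst_trans Hxy Hyz.
Qed.

Canonical geq_equiv (T : choiceType) (r : T -> T -> Prop) : equiv_rel T :=
  EquivRel (geq r) (@geq_refl T r) (@geq_sym T r) (@geq_trans T r).

Definition gquot (X : topologicalType) (r : X -> X -> Prop) : topologicalType :=
  quotient_topology {eq_quot (geq_equiv r)}.

Definition spath (V : finType) (E : rel V) (x y : V) (p : seq V) : bool :=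
  [&& path (fun a b => (a != b) && E a b) x p, last x p == y & uniq (x :: p)].

Definition is_tree (V : finType) (E : rel V) : Prop :=
  forall x y : V, exists! p, spath E x y p.

Record rtree := RTree {
  rV :> finType;
  rE : rel rV;
  rroot : rV;
  rE_refl : reflexive rE;
  rE_sym : symmetric rE;
  r_tree : is_tree rE;
  r_card : (1 < #|rV|)%N
}.
Arguments rE : clear implicits.
Arguments rroot : clear implicits.

Definition tle (A : rtree) (x y : A) : Prop :=
  exists p, spath (rE A) (rroot A) y p /\ x \in rroot A :: p.

Definition epi (A B : rtree) (f : A -> B) : Prop :=
  [/\ forall a b, rE A a b -> rE B (f a) (f b),
      forall c : B, exists a, f a = c,
      forall c d : B, rE B c d -> exists a b, [/\ rE A a b, f a = c & f b = d],
      f (rroot A) = rroot B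
    & forall x y, tle x y -> tle (f x) (f y)].

(** Connectedness of a set of vertices of a finite graph (all vertex sets are
    closed, the topology being discrete). *)
Definition gconnected (V : finType) (E : rel V) (Q : {set V}) : Prop :=
  ~ exists A B : {set V},
      [/\ #|A| != 0, #|B| != 0, [disjoint A & B], A :|: B = Q
        & forall a b, a \in A -> b \in B -> ~~ E a b].

Definition gcomponent (V : finType) (E : rel V) (P K : {set V}) : Prop :=
  [/\ K \subset P, #|K| != 0, gconnected E K
    & forall K' : {set V}, K \subset K' -> K' \subset P -> gconnected E K' -> K' = K].

Definition confluent (A B : rtree) (f : A -> B) : Prop :=
  forall Q : {set B}, gconnected (rE B) Q ->
    forall K, gcomponent (rE A) (f @^-1: Q) K -> f @: K = Q.

Definition light (A B : rtree) (f : A -> B) : Prop :=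
  forall a b, a != b -> f a = f b -> ~~ rE A a b.

(** Splitting edge maps: [A] is obtained from [B] by replacing the edge
    <f a, f b> (f a < f b) by <f a, x>, <x, f b> with a new vertex [x];
    [f] is a bijection (identification) off [x] and sends [x] to [f a] or
    [f b]. *)
Definition splitting (A B : rtree) (f : A -> B) : Prop :=
  exists x a b : A,
    [/\ x != rroot A, a != x, b != x & a != b] /\
    (forall u, rE A x u = [|| u == x, u == a | u == b]) /\
    ~~ rE A a b /\
    {in [pred u | u != x] &, injective f} /\
    (forall c : B, exists2 u, u != x & f u = c) /\
    (forall u v, u != x -> v != x ->
       rE B (f u) (f v) = [|| rE A u v, (u == a) && (v == b) | (u == b) && (v == a)]) /\
    f (rroot A) = rroot B /\
    (f x = f a \/ f x = f b) /\
    (f a != f b /\ tle (f a) (f b)).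

Inductive sc : forall A B : rtree, (A -> B) -> Prop :=
| sc_split (A B : rtree) (f : A -> B) : splitting f -> sc f
| sc_lce (A B : rtree) (f : A -> B) : epi f -> light f -> confluent f -> sc f
| sc_comp (A B C : rtree) (f : A -> B) (g : B -> C) : sc f -> sc g -> sc (g \o f).

Section InvLim.
Local Open Scope classical_set_scope.
Variables (F : nat -> rtree) (alpha : forall n, F n.+1 -> F n).

Definition lim_threads : set (prod_topology (fun n => discrete_topology (F n))) :=
  [set x : prod_topology (fun n => discrete_topology (F n)) |
     forall n, @alpha n (x n.+1) = x n].

Definition limV : topologicalType := set_type lim_threads.

Definition limE (x y : limV) : Prop :=
  forall n, rE (F n) (set_val x n) (set_val y n).

Definition admissible (A : rtree) (h : limV -> A) : Prop :=
  exists m (h' : F m -> A), sc h' /\ forall x : limV, h x = h' (set_val x m).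

Definition fraisse_limit : Prop :=
  (forall n, sc (@alpha n)) /\
  (forall A : rtree, exists h : limV -> A, admissible h) /\
  (forall (A B : rtree) (f : limV -> A) (g : B -> A),
      admissible f -> sc g -> exists h : limV -> B, admissible h /\ f =1 g \o h).

Definition realization : topologicalType := gquot limE.

End InvLim.

Section MN.
Local Open Scope classical_set_scope.
Variables (R : realType) (d : nat -> R).
(* 0-indexed: [d n] stands for the paper's d_{n+1}. *)

Definition MN_sequence : Prop :=
  [/\ forall n, 0 <= d n < 1,
      forall x : R, 0 <= x < 1 -> forall e : R, 0 < e -> exists n, `|d n - x| < e,
      exists n, d n = 0
    & forall n N, exists m, (N < m)%N /\ d m = d n]%R.

(** [Y n] together with [g^n_0 : Y n -> Y 0 = [0,1] ⊂ R]. *)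
Fixpoint MNY (n : nat) : {X : topologicalType & X -> R} :=
  match n with
  | 0 => existT (fun X : topologicalType => X -> R)
           (set_type (`[0%R, 1%R] : set R) : topologicalType) (@set_val R `[0%R, 1%R])
  | n'.+1 =>
      existT (fun X : topologicalType => X -> R)
        (gquot (fun p q : projT1 (MNY n') * bool =>
                  p.1 = q.1 /\ (projT2 (MNY n') p.1 <= d n')%R))
        (fun q => projT2 (MNY n') (repr q).1)
  end.

Definition MNg (n : nat) : projT1 (MNY n.+1) -> projT1 (MNY n) :=
  fun q => (repr q).1.

Definition MN_dendroid : topologicalType :=
  set_type [set y : prod_topology (fun n => projT1 (MNY n)) |
             forall n, MNg (y n.+1) = y n].

End MN.

(* Main.v *)
(** A code [s] in the Cantor set names an arc of the Mohler-Nikiel dendroid, and two points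
    [(s, t)], [(s', t)] of the product of the Cantor set with [0,1] are identified when [t] is at
    most every [d i] with [s i <> s' i].  A chart on a finite tree [A] sends each of these arcs
    onto a branch of [A] and gives every vertex of the branch a height, its core, at which all
    the branching at that vertex takes place.  Because every value [d i] is repeated infinitely
    often, a chart can be lifted along any simple-confluent epimorphism: a splitting inserts a
    new core between two old ones, and a light confluent map spends unused bits whose height is
    exactly that of the core.  Conversely, by inserting cores and then separating the arcs that
    use different bits, any chart is refined over some simple-confluent epimorphism until its
    cells are as small as desired.  Alternating this with the extension property of the Fraisse
    limit yields charts on a cofinal sequence of its levels whose cells shrink to the points of
    the dendroid; a thread is sent to the point its cells shrink to.  Adjacent threads have the
    same image because their cells meet; the converse follows since a third vertex between two
    non-adjacent ones could be separated from one of them by splitting an edge. *)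
From HB Require Import structures.
Require Import Defs.
From mathcomp Require Import all_boot all_order all_algebra generic_quotient lra.
From mathcomp Require Import all_classical all_reals.
From mathcomp Require Import topology normedtype.

Set Implicit Arguments.
Unset Strict Implicit.
Unset Printing Implicit Defensive.

Import Order.TTheory GRing.Theory Num.Theory.
Import numFieldTopology.Exports.

(** * Trees given by parent functions *)

(** The family is defined through simple paths and components, the dendroid through iterated
    quotients, and both are recoded before they meet. A rooted tree becomes its parent function;
    light confluent epimorphisms are then exactly the coverings, which send parents to parents and
    lift every child. The dendroid becomes a quotient of the Cantor set times the interval, where
    compactness is at hand.

    The delicate point of a chart is what happens at a core. Codes related by [agree] at the core of
    a vertex both run through it but may leave towards different children; codes related by [sagree]
    there leave towards the same child. So the bits that branch at a vertex have exactly the height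
    of its core, which forces the core of a vertex with children to be one of the values [d i], and
    every further covering consumes new bits of that same value. *)

Section ParentGraph.
Variables (V : finType) (r : V) (par : V -> V) (rk : V -> nat).
Hypothesis rk_par : forall x, x != r -> rk (par x) < rk x.

Definition pedge : rel V :=
  fun x y => [|| x == y, (x != r) && (par x == y) | (y != r) && (par y == x)].

Lemma pedge_refl : reflexive pedge.
Proof. by move=> x; rewrite /pedge eqxx. Qed.

Lemma pedge_sym : symmetric pedge.
Proof. by move=> x y; rewrite /pedge eq_sym orbCA orbC -!orbA; case: (y == x) => //=; rewrite orbC. Qed.

Let sedge : rel V := fun a b => (a != b) && pedge a b.

Lemma sedge_sym : symmetric sedge.
Proof. by move=> x y; rewrite /sedge eq_sym pedge_sym. Qed.

Lemma sedgeP x y : sedge x y -> (x != r /\ y = par x) \/ (y != r /\ x = par y).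
Proof.
case/andP=> ne /or3P[/eqP e|/andP[h /eqP e]|/andP[h /eqP e]].
- by rewrite e eqxx in ne.
- by left.
- by right.
Qed.

Lemma spathE x y p : spath pedge x y p = [&& path sedge x p, last x p == y & uniq (x :: p)].
Proof. by []. Qed.

Lemma spath_rev x y p : spath pedge x y p -> spath pedge y x (rev (belast x p)).
Proof.
rewrite !spathE => /and3P[pp /eqP lp up]; apply/and3P; split.
- by rewrite -lp rev_path (eq_path (e' := sedge)) // => a b /=; rewrite sedge_sym.
- by case: p lp {pp up} => [|a p] /= lp; rewrite ?lp // rev_cons last_rcons.
- by rewrite -lp -rev_rcons -lastI rev_uniq.
Qed.

(* After a step away from the root a simple path can never turn back. *)
Lemma descend_rk p x w : w != r -> par w = x -> path sedge w p -> uniq (x :: w :: p) ->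
  rk x < rk (last w p).
Proof.
elim: p x w => [|z p IH] x w wr pw /= => [_ _|/andP[e pp] u].
  by rewrite -pw rk_par.
have [[h ze]|[zr we]] := sedgeP e.
  by move: u; rewrite ze pw !inE eqxx !orbT.
have := IH w z zr (esym we) pp; case/andP: u => _ /[swap] /[apply].
by apply: ltn_trans; rewrite -pw rk_par.
Qed.

(** If the first step left [x] for a child, [descend_rk] would give the other end a larger rank than
    [x]; so an end of maximal rank starts towards its parent. *)
Lemma spath_up x y p : rk y <= rk x -> x != y -> spath pedge x y p ->
  exists q, [/\ x != r, p = par x :: q & spath pedge (par x) y q].
Proof.
move=> rxy nxy; rewrite spathE => /and3P[]; case: p => [|w q] /=.
  by move=> _ /eqP e; rewrite e eqxx in nxy.
move=> /andP[e pq] /eqP lq u.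
have [[xr we]|[wr xe]] := sedgeP e.
  by exists q; split=> //; rewrite -?we // spathE pq lq eqxx; case/andP: u.
have := descend_rk wr (esym xe) pq u.
by rewrite lq ltnNge rxy.
Qed.

Lemma spath_nil (E : rel V) z p : spath E z z p -> p = [::].
Proof.
case: p => // w p; rewrite /spath => /and3P[_ /eqP /= lw /andP[zn _]].
by move: zn; rewrite -{1}lw mem_last.
Qed.

Lemma pspath_unique x y p q : spath pedge x y p -> spath pedge x y q -> p = q.
Proof.
have [n] := ubnP (rk x + rk y); elim: n x y p q => // n IH x y p q ltn.
have [<-|nxy] := eqVneq x y; first by move=> /spath_nil-> /spath_nil->.
wlog rxy : x y p q ltn nxy / rk y <= rk x.
  move=> H; have [|/ltnW] := leqP (rk y) (rk x); first exact: H.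
  move=> h sp sq; have := H y x _ _ _ _ h (spath_rev sp) (spath_rev sq).
  rewrite addnC eq_sym => /(_ ltn nxy) /(congr1 rev); rewrite !revK.
  move: sp sq; rewrite !spathE => /and3P[_ /eqP lp _] /and3P[_ /eqP lq _] e.
  have : x :: p = x :: q by rewrite (lastI x p) (lastI x q) lp lq e.
  by case.
move=> /(spath_up rxy nxy)[p' [xr -> sp]] /(spath_up rxy nxy)[q' [_ -> sq]].
congr cons; apply: IH sp sq.
by apply: leq_trans (_ : rk x + rk y <= n) => //; rewrite ltn_add2r rk_par.
Qed.

Lemma pspath_exists x y : exists p, spath pedge x y p.
Proof.
have cs : connect_sym sedge.
  move=> a b; rewrite -[LHS]connect_rev; apply: eq_connect => u v /=.
  by rewrite sedge_sym.
have toroot z : connect sedge z r.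
  have [n] := ubnP (rk z); elim: n z => // n IH z ltn.
  have [->|zr] := eqVneq z r; first exact: connect0.
  apply: (@connect_trans _ _ (par z)).
    apply: connect1; rewrite /sedge /pedge zr eqxx orbT andbT.
    by apply: contraTneq (rk_par zr) => <-; rewrite ltnn.
  by apply: IH; apply: leq_trans (rk_par zr) _.
have : connect sedge x y by apply: connect_trans (toroot x) _; rewrite cs.
case/connectP => p pp ->; case/shortenP: pp => q pq uq _.
by exists q; rewrite spathE pq uq eqxx.
Qed.

Lemma parent_graph_tree : is_tree pedge.
Proof.
move=> x y; have [p sp] := pspath_exists x y.
by exists p; split=> // q; apply: pspath_unique.
Qed.

End ParentGraph.

(** All new trees are built this way: a rank that drops along the parent function already guarantees
    unique simple paths. *)
Definition parent_tree (V : finType) (r : V) (par : V -> V) (rk : V -> nat)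
    (rk_par : forall x, x != r -> rk (par x) < rk x) (V2 : 1 < #|V|) : rtree :=
  @RTree V (pedge r par) r (@pedge_refl _ r par) (@pedge_sym _ r par)
    (parent_graph_tree rk_par) V2.

(** * Parents, ancestors and depth in an arbitrary rooted tree *)

Section Parent.
Variable A : rtree.
Implicit Types x y : A.
Local Notation root := (rroot A).
Local Notation E := (rE A).

Definition branch y : seq A := projT1 (cid (r_tree root y)).

Lemma branch_spath y : spath E root y (branch y).
Proof. by rewrite /branch; case: cid => p []. Qed.

Lemma branch_unique y p : spath E root y p -> p = branch y.
Proof. by rewrite /branch; case: cid => q /= [_ +] h => /(_ _ h). Qed.

Definition par y : A := last root (belast root (branch y)).
Definition depth y := size (branch y).

Lemma branch_root : branch root = [::].
Proof. exact: spath_nil (branch_spath root). Qed.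

Lemma branch_rcons y : y != root ->
  branch y = rcons (branch (par y)) y /\ (par y != y) && E (par y) y.
Proof.
move=> yr; have := branch_spath y; rewrite /par /spath.
case/lastP: (branch y) => [|p z]; first by case/and3P=> _ /eqP e; rewrite -e eqxx in yr.
rewrite rcons_path last_rcons belast_rcons -rcons_cons rcons_uniq => /and3P[/andP[pp e] /eqP<-{y yr}].
case/andP=> _ u; rewrite /= e; split=> //; congr rcons; apply: branch_unique.
by rewrite /spath pp eqxx.
Qed.

Lemma depth_par y : y != root -> depth y = (depth (par y)).+1.
Proof. by move=> /branch_rcons[h _]; rewrite /depth h size_rcons. Qed.

Lemma par_neq y : y != root -> par y != y.
Proof. by move=> /branch_rcons[_ /andP[]]. Qed.

Lemma par_edge y : y != root -> E (par y) y.
Proof. by move=> /branch_rcons[_ /andP[]]. Qed.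

Lemma spath_rcons p x y : spath E root x p -> x != y -> E x y -> y \notin root :: p ->
  spath E root y (rcons p y).
Proof.
rewrite /spath => /and3P[pp /eqP lp up] ne e yp.
by rewrite rcons_path last_rcons -rcons_cons rcons_uniq pp lp ne e yp up /= eqxx.
Qed.

(** If [y] is off the branch of [x], appending [y] gives the branch of [y], so [x] is its parent.
    Otherwise the branch of [x] is cut at [y]; the cut part avoids [x], and the same argument
    applies with the roles exchanged. *)
Lemma rE_par x y : E x y = pedge root par x y.
Proof.
apply/idP/or3P; last first.
  case=> [/eqP->|/andP[h /eqP<-]|/andP[h /eqP<-]]; first exact: rE_refl.
    by rewrite rE_sym par_edge.
  by rewrite par_edge.
have [->|ne e] := eqVneq x y; first by constructor 1.
have parE u v p : spath E root u p -> u != v -> E u v -> v \notin root :: p ->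
    (v != root) && (par v == u).
  move=> sp nuv euv vp; have s := spath_rcons sp nuv euv vp.
  have vr : v != root by apply: contra vp => /eqP->; rewrite inE eqxx.
  have [h _] := branch_rcons vr; rewrite vr.
  have := branch_unique s; rewrite h => /rcons_inj[h'].
  have := branch_spath (par v); rewrite -h'; move: sp.
  by rewrite /spath /= => /and3P[_ /eqP-> _] /and3P[_ /eqP-> _].
have [yp|yp] := boolP (y \in root :: branch x); last first.
  by constructor 3; apply: (parE _ _ _ (branch_spath x)).
constructor 2.
have := branch_spath x; rewrite /spath => /and3P[pp /eqP lp].
case/splitPl: yp pp lp => p1 p2 l1; rewrite cat_path last_cat -cat_cons cat_uniq.
case/andP=> pp1 pp2 lp /and3P[u1 hn _].
apply: (@parE y x p1); rewrite 1?eq_sym 1?rE_sym //; first by rewrite /spath pp1 l1 eqxx.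
have xp2 : x \in p2.
  case: p2 lp {hn pp2} => [|a p2] /=; last by move=> <-; rewrite mem_last.
  by rewrite l1 => e'; rewrite e' eqxx in ne.
by apply: contra hn => xp1; apply/hasP; exists x.
Qed.

Definition anc x y := x \in root :: branch y.

Lemma anc_root y : anc root y.
Proof. by rewrite /anc inE eqxx. Qed.

Lemma anc_refl y : anc y y.
Proof.
rewrite /anc; have /and3P[_ /eqP h _] := branch_spath y.
by rewrite -{1}h mem_last.
Qed.

Lemma anc_par x y : y != root -> anc x y = (x == y) || anc x (par y).
Proof. by move=> yr; rewrite /anc (branch_rcons yr).1 !inE mem_rcons inE orbCA. Qed.

Lemma anc_toroot x : anc x root -> x = root.
Proof. by rewrite /anc branch_root !inE => /eqP. Qed.

Lemma tleP x y : tle x y <-> anc x y.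
Proof.
split=> [[p [/branch_unique-> //]]|h].
by exists (branch y); split=> //; apply: branch_spath.
Qed.

Lemma par_ind (Q : A -> Prop) :
  Q root -> (forall y, y != root -> Q (par y) -> Q y) -> forall y, Q y.
Proof.
move=> Q0 QS y; have [n] := ubnP (depth y); elim: n y => // n IH y ltn.
have [->//|yr] := eqVneq y root; apply: QS (yr) _; apply: IH.
by move: ltn; rewrite (depth_par yr).
Qed.

Lemma anc_trans : transitive anc.
Proof.
move=> y x z xy; elim/par_ind: z => [/anc_toroot<-//|z zr IH].
by rewrite !(anc_par _ zr) => /orP[/eqP e|/IH ->]; rewrite ?orbT // -anc_par // -e.
Qed.

Lemma anc_depth x y : anc x y -> depth x <= depth y.
Proof.
elim/par_ind: y => [/anc_toroot->//|y yr IH].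
by rewrite (anc_par _ yr) (depth_par yr) => /orP[/eqP->|/IH/leqW]; rewrite ?(depth_par yr).
Qed.

Lemma par_anc y : y != root -> anc (par y) y.
Proof. by move=> yr; rewrite anc_par // anc_refl orbT. Qed.

(** This recognises parents in a tree known by its edges. From vertices of rank below that of [y],
    ranks do not grow towards the root, so [y] is no ancestor of [p y], and of the two ends of their
    edge [p y] must be the parent. *)
Lemma par_unique (p : A -> A) (rk : A -> nat) :
  (forall y, y != root -> rk (p y) < rk y /\ E (p y) y) ->
  forall y, y != root -> par y = p y.
Proof.
move=> h y; have [n] := ubnP (rk y); elim: n y => // n IH y ltn yr.
have [hlt he] := h _ yr.
have IHp z : rk z < rk y -> z != root -> par z = p z.
  by move=> lt; apply: IH; apply: leq_trans lt _.
have ancrk z : rk z < rk y -> forall w, anc w z -> rk w <= rk z.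
  elim/par_ind: z => [_ w /anc_toroot-> //|z zr IHz lt w].
  rewrite (anc_par _ zr) => /orP[/eqP->//|]; have [ltz _] := h _ zr.
  rewrite (IHp _ lt zr) in IHz *.
  by move=> /(IHz (ltn_trans ltz lt))/leq_trans; apply; apply: ltnW.
move: he; rewrite rE_par => /or3P[/eqP e|/andP[pr /eqP e]|/andP[_ /eqP]//].
  by move: hlt; rewrite e ltnn.
have := ancrk _ hlt y; rewrite (anc_par _ pr) e anc_refl orbT => /(_ isT).
by rewrite leqNgt hlt.
Qed.

Lemma exists_nonroot : exists y, y != root.
Proof.
have := r_card A; rewrite (cardD1 root) inE add1n ltnS lt0n => /existsP[y].
by rewrite !inE andbT; exists y.
Qed.

End Parent.

Lemma parent_treeE (V : finType) (r : V) (p : V -> V) (rk : V -> nat)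
    (rkp : forall x, x != r -> rk (p x) < rk x) (V2 : 1 < #|V|)
    (y : parent_tree rkp V2) :
  y != r -> par y = p y.
Proof.
move=> yr; apply: (@par_unique (parent_tree rkp V2) p rk) => // z zr; split; first exact (rkp z zr).
by rewrite /= /pedge (zr : z != r) eqxx !orbT.
Qed.

(** * Light confluent epimorphisms *)

Section Child.
Variable A : rtree.
Implicit Types v w : A.

Definition child v w := (w != rroot A) && (par w == v).

Lemma childP v w : reflect (w != rroot A /\ par w = v) (child v w).
Proof. by apply: (iffP andP) => -[? /eqP]. Qed.

Lemma child_par w : w != rroot A -> child (par w) w.
Proof. by move=> h; rewrite /child h eqxx. Qed.

Lemma child_neq v w : child v w -> v != w.
Proof. by move=> /childP[wr <-]; apply: par_neq. Qed.

Lemma child_depth v w : child v w -> depth w = (depth v).+1.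
Proof. by move=> /childP[wr <-]; apply: depth_par. Qed.

Lemma child_edge v w : child v w -> rE A v w.
Proof. by move=> /childP[wr <-]; apply: par_edge. Qed.

Lemma edgeP v w : rE A v w -> [\/ v = w, child v w | child w v].
Proof.
rewrite rE_par => /or3P[/eqP->|h|h]; first by constructor 1.
  by constructor 3.
by constructor 2.
Qed.

Lemma anc_child v w u : child v w -> anc u w = (u == w) || anc u v.
Proof. by move=> /childP[wr <-]; apply: anc_par. Qed.

Lemma child_anc v w : child v w -> anc v w.
Proof. by move=> h; rewrite (anc_child _ h) anc_refl orbT. Qed.

Lemma child_anti v w : child v w -> ~~ anc w v.
Proof. by move=> /child_depth h; apply/negP => /anc_depth; rewrite h ltnn. Qed.

Lemma anc_neq_child v w : anc v w -> v != w -> exists2 u, child v u & anc u w.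
Proof.
elim/par_ind: w => [/anc_toroot-> /eqP//|w wr IH].
rewrite (anc_par _ wr) => /orP[/eqP->/eqP//|vp nvw].
have [e|ne] := eqVneq v (par w); first by exists w; rewrite ?anc_refl // e child_par.
by have [u vu up] := IH vp ne; exists u => //; apply: anc_trans up (par_anc wr).
Qed.

End Child.

(* Tree coverings: the parent-function description of light confluent epimorphisms. *)
Definition covering (B A : rtree) (g : B -> A) : Prop :=
  [/\ g (rroot B) = rroot A,
      forall w, w != rroot B -> g w != rroot A /\ g (par w) = par (g w)
    & forall v c, child (g v) c -> exists2 w, child v w & g w = c].

Section Covering.
Variables (B A : rtree) (g : B -> A).
Hypothesis cg : covering g.

Lemma covering_child v w : child v w -> child (g v) (g w).
Proof. by case: cg => _ h _ /childP[wr <-]; have [gr ->] := h _ wr; apply: child_par. Qed.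

Lemma covering_edge v w : rE B v w -> rE A (g v) (g w).
Proof.
move=> /edgeP[->|/covering_child/child_edge//|/covering_child/child_edge].
  exact: rE_refl.
by rewrite rE_sym.
Qed.

Lemma covering_anc v w : anc v w -> anc (g v) (g w).
Proof.
elim/par_ind: w => [/anc_toroot->|w wr IH]; first exact: anc_refl.
have h := covering_child (child_par wr).
rewrite (anc_par _ wr) (anc_child _ h) => /orP[/eqP->|/IH->]; rewrite ?eqxx ?orbT //.
Qed.

Lemma covering_onto c : exists v, g v = c.
Proof.
elim/par_ind: c => [|c cr [v gv]]; first by case: cg => h _ _; exists (rroot B).
case: cg => _ _ /(_ v c); rewrite gv => /(_ (child_par cr))[w _ gw].
by exists w.
Qed.

Lemma covering_epi : epi g.
Proof.
have [g0 _ gl] := cg; split=> //.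
- exact: covering_edge.
- exact: covering_onto.
- move=> c c' /edgeP[->|h|h].
  + by have [v gv] := covering_onto c'; exists v, v; split=> //; apply: rE_refl.
  + have [v gv] := covering_onto c; rewrite -gv in h.
    by have [w /child_edge e gw] := gl _ _ h; exists v, w.
  + have [v gv] := covering_onto c'; rewrite -gv in h.
    by have [w /child_edge e gw] := gl _ _ h; exists w, v; rewrite rE_sym.
- by move=> v w /tleP/covering_anc/tleP.
Qed.

Lemma covering_light : light g.
Proof.
move=> v w nvw gvw; apply/negP => /edgeP[e|h|h].
- by rewrite e eqxx in nvw.
- by have := child_neq (covering_child h); rewrite gvw eqxx.
- by have := child_neq (covering_child h); rewrite gvw eqxx.
Qed.

Lemma gconnected_setU1 (V : finType) (E : rel V) (K : {set V}) k k' :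
  symmetric E -> gconnected E K -> k \in K -> E k k' -> gconnected E (k' |: K).
Proof.
move=> sE cK kK e; have [k'K|k'K] := boolP (k' \in K).
  by rewrite (finset.setUidPr _) // finset.sub1set.
move=> [P [Q [P0 Q0 dPQ PQ sep]]]; apply: cK.
wlog kP : P Q P0 Q0 dPQ PQ sep / k \in P.
  move=> H; have : k \in P :|: Q by rewrite PQ inE kK orbT.
  rewrite inE => /orP[kP|kQ]; first exact: (H P Q).
  apply: (H Q P) => //; [by rewrite disjoint_sym|by rewrite finset.setUC|].
  by move=> a b aQ bP; rewrite sE sep.
have k'P : k' \in P.
  have : k' \in P :|: Q by rewrite PQ !inE eqxx.
  by rewrite inE => /orP[//|k'Q]; have := sep _ _ kP k'Q; rewrite e.
exists (P :\ k'), Q; split=> //.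
- rewrite cards_eq0; apply/finset.set0Pn; exists k; rewrite !inE kP andbT.
  by apply: contraNneq k'K => <-.
- by apply: disjointWl dPQ; apply: finset.subsetDl.
- apply/finset.setP => z; rewrite !inE; have [->|nz] := eqVneq z k'.
    by rewrite (negbTE k'K) /=; apply: (disjointFr dPQ).
  by move/finset.setP: PQ => /(_ z); rewrite !inE (negbTE nz).
- by move=> a b; rewrite !inE => /andP[_ aP] bQ; apply: sep.
Qed.

(** If the image of [K] missed part of [Q], an edge inside [Q] would leave it; a covering lifts that
    edge from a vertex of [K], to a child or to the parent, and the lifted end could be added to the
    maximal [K]. *)
Lemma covering_confluent : confluent g.
Proof.
move=> Q cQ K [KQ K0 cK maxK].
have gKQ : g @: K \subset Q.
  by apply/fintype.subsetP => _ /finset.imsetP[k /(fintype.subsetP KQ) + ->]; rewrite inE.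
apply/eqP; rewrite finset.eqEsubset gKQ /=; apply/negPn/negP => nQ; apply: cQ.
exists (g @: K), (Q :\: g @: K); split.
- by move: K0; rewrite !cards_eq0 imset_eq0.
- by rewrite cards_eq0 finset.setD_eq0.
- by rewrite disjoint_sym finset.disjoints_subset; apply/fintype.subsetP => c; rewrite !inE => /andP[].
- apply/finset.setP => c; rewrite !inE; have := fintype.subsetP gKQ c; case: (c \in g @: K) => //= -> //.
move=> _ c /finset.imsetP[k kK ->]; rewrite inE => /andP[cK' cQ']; apply/negP => e.
have [k' ekk' gk'] : exists2 k', rE B k k' & g k' = c.
  case: cg => g0 gp gl; case/edgeP: e => [<-|h|h].
  - by exists k; rewrite ?rE_refl.
  - by have [w /child_edge ? ?] := gl _ _ h; exists w.
  - have kr : k != rroot B.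
      by apply: contraTneq h => ->; rewrite g0 /child eqxx.
    exists (par k); first by rewrite rE_sym par_edge.
    by have [_ ->] := gp _ kr; case/childP: h.
move/negP: cK'; apply; apply/finset.imsetP; exists k' => //.
have := maxK (k' |: K); rewrite finset.subsetUr => /(_ isT) <-; rewrite ?inE ?eqxx //.
  by rewrite finset.subUset finset.sub1set inE gk' cQ' KQ.
by apply: gconnected_setU1 kK ekk' => //; apply: rE_sym.
Qed.

Lemma covering_sc : sc g.
Proof.
by apply: sc_lce; [apply: covering_epi|apply: covering_light|apply: covering_confluent].
Qed.

End Covering.

Lemma gconnected1 (V : finType) (E : rel V) v : gconnected E [set v].
Proof.
move=> [P [Q [P0 Q0 dPQ PQ _]]].
move: P0 Q0; rewrite !cards_eq0 => /finset.set0Pn[p pP] /finset.set0Pn[q qQ].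
have /set1P ep : p \in [set v] by rewrite -PQ inE pP.
have /set1P eq : q \in [set v] by rewrite -PQ inE qQ orbT.
by have := disjointFr dPQ pP; rewrite ep -eq qQ.
Qed.

Lemma component_exists (V : finType) (E : rel V) (P : {set V}) v : v \in P ->
  exists2 K, gcomponent E P K & v \in K.
Proof.
move=> vP; pose ok (K : {set V}) := [&& v \in K, K \subset P & `[< gconnected E K >]].
have ok1 : ok [set v].
  by rewrite /ok inE eqxx finset.sub1set vP; apply/asboolP; apply: gconnected1.
case: (arg_maxnP (fun K : {set V} => #|K|) ok1) => K /and3P[vK KP /asboolP cK] maxK.
exists K => //; split=> //; first by rewrite -lt0n; apply/card_gt0P; exists v.
move=> K' KK' K'P cK'; apply/esym/eqP; rewrite finset.eqEcard KK'; apply: maxK.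
by rewrite /ok (fintype.subsetP KK') // K'P; apply/asboolP.
Qed.

Lemma gconnected2 (V : finType) (E : rel V) v w : symmetric E -> E v w ->
  gconnected E [set v; w].
Proof.
move=> sE e; rewrite finset.setUC; apply: gconnected_setU1 e => //; first exact: gconnected1.
by rewrite inE.
Qed.

(** Lightness forbids collapsing an edge and monotonicity forbids reversing it, so parents go to
    parents. To lift a child [c] of [g v], confluence is applied to the edge from [g v] to [c]:
    without a lift, [v] would be isolated in its component, since lightness excludes neighbours over
    [g v] and the parent of [v] cannot lie over [c]. *)
Lemma lce_covering (B A : rtree) (g : B -> A) :
  epi g -> light g -> confluent g -> covering g.
Proof.
move=> [gE _ _ g0 gt] gl gc.
have gpar w : w != rroot B -> child (g (par w)) (g w).
  move=> wr; have ne := par_neq wr.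
  have /edgeP[e|//|h] := gE _ _ (par_edge wr).
    by have := gl _ _ ne e; rewrite par_edge.
  have /tleP := gt _ _ (iffRL (tleP _ _) (par_anc wr)).
  by rewrite (negbTE (child_anti h)).
split=> // [w /gpar/childP[]//|v c vc].
have cQ : gconnected (rE A) [set g v; c].
  by apply: gconnected2 (child_edge vc); apply: rE_sym.
have vQ : v \in g @^-1: [set g v; c] by rewrite !inE eqxx.
have [K cK vK] := component_exists (rE B) vQ.
have := gc _ cQ _ cK; case: cK => KQ K0 cK _ gK.
apply: contrapT => noc; apply: cK; exists [set v], (K :\ v).
have nbr k : k \in K -> rE B v k -> k = v.
  move=> kK e; apply: contrapT => nkv; have nkv' : v != k by apply/eqP => /esym.
  have := fintype.subsetP KQ _ kK; rewrite !inE => /orP[/eqP ek|/eqP ek].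
    by have := gl _ _ nkv' (esym ek); rewrite e.
  case/edgeP: e => [/esym//|h|h]; first by apply: noc; exists k.
  have /childP[vr pv] := h; have := gpar _ vr; rewrite pv ek => h'.
  by have := child_anti vc; rewrite (child_anc h').
split.
- by rewrite cards1.
- have : c \in g @: K by rewrite gK !inE eqxx orbT.
  case/finset.imsetP => k kK ck; rewrite cards_eq0; apply/finset.set0Pn; exists k.
  rewrite !inE kK andbT; apply/eqP => kv.
  by have := child_neq vc; rewrite ck kv eqxx.
- by rewrite finset.disjoints_subset finset.sub1set !inE eqxx.
- by rewrite finset.setD1K.
- move=> a k /set1P->; rewrite !inE => /andP[nk kK]; apply/negP => /(nbr _ kK) e.
  by rewrite e eqxx in nk.
Qed.

(** * Splitting edge maps *)

(** The body of [splitting] with its witnesses exposed, so that the new vertex and the ends of the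
    split edge can be named. *)
Definition split_at (B A : rtree) (f : B -> A) (x a b : B) : Prop :=
  [/\ x != rroot B, a != x, b != x & a != b] /\
  (forall u, rE B x u = [|| u == x, u == a | u == b]) /\
  ~~ rE B a b /\
  {in [pred u | u != x] &, injective f} /\
  (forall c : A, exists2 u, u != x & f u = c) /\
  (forall u v, u != x -> v != x ->
     rE A (f u) (f v) = [|| rE B u v, (u == a) && (v == b) | (u == b) && (v == a)]) /\
  f (rroot B) = rroot A /\
  (f x = f a \/ f x = f b) /\
  (f a != f b /\ tle (f a) (f b)).

Section SplitAt.
Variables (B A : rtree) (f : B -> A) (x a b : B).
Hypothesis sp : split_at f x a b.

Lemma split_neq : [/\ x != rroot B, a != x, b != x & a != b].
Proof. by case: sp. Qed.

Lemma split_inj u v : u != x -> v != x -> f u = f v -> u = v.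
Proof. by case: sp => _ [_ [_ [h _]]] ux vx; apply: h. Qed.

Lemma split_onto c : exists2 u, u != x & f u = c.
Proof. by case: sp => _ [_ [_ [_ [h _]]]]. Qed.

Lemma split_root : f (rroot B) = rroot A.
Proof. by case: sp => _ [_ [_ [_ [_ [_ [h _]]]]]]. Qed.

Lemma split_new : f x = f a \/ f x = f b.
Proof. by case: sp => _ [_ [_ [_ [_ [_ [_ [h _]]]]]]]. Qed.

Lemma split_old_edge : child (f a) (f b).
Proof.
have [_ ax bx _] := split_neq.
case: sp => _ [_ [_ [_ [_ [h [_ [_ [ne /tleP an]]]]]]]].
have /edgeP[e|//|c] : rE A (f a) (f b) by rewrite h // !eqxx !orbT.
  by rewrite e eqxx in ne.
by have := child_anti c; rewrite an.
Qed.

Lemma split_nonroot v : v != x -> v != rroot B -> f v != rroot A.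
Proof.
have [xr _ _ _] := split_neq.
move=> vx; apply: contraNneq; rewrite -split_root => /split_inj-> //.
by rewrite eq_sym.
Qed.

Lemma split_b_nonroot : b != rroot B.
Proof.
apply/eqP => e; have /childP[+ _] := split_old_edge.
by rewrite e split_root eqxx.
Qed.

Let old c : B := projT1 (cid2 (split_onto c)).
Let oldx c : old c != x. Proof. by rewrite /old; case: cid2. Qed.
Let fold c : f (old c) = c. Proof. by rewrite /old; case: cid2. Qed.

(** The candidate parent function and a rank for [par_unique]: depths are doubled to free an odd
    value for [x] between [a] and [b]. *)
Let q v := if v == x then a else if v == b then x else old (par (f v)).
Let rk v := if v == x then (depth (f b)).*2.-1 else (depth (f v)).*2.

Let parq v : v != rroot B -> par v = q v.
Proof.
have [xr ax bx ab] := split_neq; have fab := split_old_edge.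
case: (sp) => _ [Ex [_ [_ [_ [Ef [_ [_ _]]]]]]].
apply: (@par_unique _ q rk) => {}v vr; rewrite /q /rk.
have [->|vx] := eqVneq v x.
  rewrite (negbTE ax) (child_depth fab) doubleS /=; split; first by rewrite ltnS.
  by rewrite rE_sym Ex eqxx orbT.
have [->|vb] := eqVneq v b.
  rewrite eqxx (child_depth fab) doubleS /=; split; first by rewrite ltnS.
  by rewrite Ex eqxx !orbT.
have fvr := split_nonroot vx vr; have fp := child_par fvr.
rewrite (negbTE (oldx _)) fold (child_depth fp) doubleS; split; first by rewrite ltnW.
have := Ef _ _ (oldx (par (f v))) vx; rewrite fold (par_edge fvr).
move=> /esym/or3P[//|/andP[_]|/andP[/eqP e /eqP va]].
  by rewrite (negbTE vb).
have := fold (par (f v)); rewrite e va => fbp.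
have := child_depth fab; rewrite fbp -va (child_depth fp) => /eqP.
by rewrite -addn2 -{1}[depth _]addn0 eqn_add2l.
Qed.

Lemma split_child_ax : child a x.
Proof. by have [xr _ _ _] := split_neq; rewrite /child xr parq // /q !eqxx. Qed.

Lemma split_child_xb : child x b.
Proof.
have [xr _ bx _] := split_neq; have br := split_b_nonroot.
by rewrite /child br parq // /q (negbTE bx) !eqxx.
Qed.

Lemma split_par v : v != x -> v != b -> v != rroot B ->
  par v != x /\ f (par v) = par (f v).
Proof. by move=> vx vb vr; rewrite parq // /q (negbTE vx) (negbTE vb) fold oldx. Qed.

Lemma split_child v : v != x -> v != b -> v != rroot B -> child (f (par v)) (f v).
Proof.
move=> vx vb vr; have [_ ->] := split_par vx vb vr.
by apply: child_par; apply: split_nonroot.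
Qed.

Lemma split_child_x w : child x w -> w = b.
Proof.
move=> /childP[wr wx]; apply: contrapT => /eqP wb.
have [wx'|wx'] := eqVneq w x; first by have := par_neq wr; rewrite wx wx' eqxx.
by have [] := split_par wx' wb wr; rewrite wx eqxx.
Qed.

Lemma split_child_old v w : v != x -> child v w ->
  (v = a /\ w = x) \/ [/\ w != x, w != b & child (f v) (f w)].
Proof.
move=> vx /childP[wr pw]; have [wx|wx] := eqVneq w x.
  by left; split=> //; rewrite -pw wx; case/childP: split_child_ax.
have [wb|wb] := eqVneq w b.
  by move: vx; rewrite -pw wb; case/childP: split_child_xb => _ ->; rewrite eqxx.
by right; split=> //; rewrite -pw; apply: split_child.
Qed.

Lemma split_lift_child v c : v != x -> child (f v) c ->
  (v = a /\ c = f b) \/ exists w, [/\ child v w, w != x, w != b & f w = c].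
Proof.
move=> vx; have [w wx <-] := split_onto c => vc.
have [wb|wb] := eqVneq w b.
  left; split; last by rewrite wb.
  have [_ ax _ _] := split_neq.
  have /childP[_ e] := split_old_edge; case/childP: vc => _ vc.
  by apply: split_inj => //; rewrite -vc wb -e.
have wr : w != rroot B.
  by apply/eqP => e; case/childP: vc => +  _; rewrite e split_root eqxx.
right; exists w; split=> //; have [px e] := split_par wx wb wr.
apply/childP; split=> //; apply: split_inj => //; rewrite e.
by case/childP: vc.
Qed.

Lemma splitting_split_at : splitting f.
Proof. by exists x, a, b. Qed.

Lemma split_edge u v : rE B u v -> rE A (f u) (f v).
Proof.
have fab := split_old_edge.
case: (sp) => _ [Ex [_ [_ [_ [Ef _]]]]].
have aux w : rE B x w -> rE A (f x) (f w).
  rewrite Ex => /or3P[/eqP->|/eqP->|/eqP->]; first exact: rE_refl.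
    by case: split_new => ->; rewrite ?rE_refl // rE_sym (child_edge fab).
  by case: split_new => ->; rewrite ?rE_refl // (child_edge fab).
have [->|ux] := eqVneq u x; first exact: aux.
have [->|vx] := eqVneq v x; first by rewrite rE_sym => /aux; rewrite rE_sym.
by move=> e; rewrite Ef // e.
Qed.

End SplitAt.

Section SplitExists.
Variables (A : rtree) (b : A).
Hypothesis br : b != rroot A.

Let par' (v : option A) : option A :=
  match v with
  | None => Some (par b)
  | Some v => if v == b then None else Some (par v)
  end.
Let rk (v : option A) := match v with None => (depth b).*2.-1 | Some v => (depth v).*2 end.

Let rk_par' v : v != Some (rroot A) -> rk (par' v) < rk v.
Proof.
case: v => [v|] /=; last by rewrite (depth_par br) doubleS /= ltnS.
move=> vr; have {}vr : v != rroot A by apply: contra vr => /eqP->.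
have [->|_] := eqVneq v b; rewrite /=.
  by rewrite (depth_par br) doubleS /= ltnS.
by rewrite (depth_par vr) doubleS ltnS.
Qed.

Let V2 : 1 < #|{: option A}|.
Proof. by rewrite card_option; apply: leqW (r_card A). Qed.

Let B := parent_tree rk_par' V2.

(* [up] tells whether the new vertex is sent to the upper endpoint [b] of the split edge. *)
Lemma split_exists (up : bool) : exists (B : rtree) (f : B -> A) (x a b' : B),
  [/\ split_at f x a b', f b' = b & f x = if up then b else par b].
Proof.
exists B, (fun v : B => odflt (if up then b else par b) (v : option A)).
exists (None : option A), (Some (par b)), (Some b); split=> //.
have pb := par_neq br; have pcb := child_par br.
have pnb : par (par b) != b.
  apply/eqP => e; have [pr|pr] := eqVneq (par b) (rroot A).
    by move: e; rewrite pr /par branch_root /= => e; case/eqP: br.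
  have := depth_par pr; rewrite e (depth_par br) => /eqP.
  by rewrite -addn2 -{1}[depth _]addn0 eqn_add2l.
have EB (u v : option A) : rE B u v = [|| u == v, (u != Some (rroot A)) && (par' u == v)
    | (v != Some (rroot A)) && (par' v == u)] by [].
have Sneq (u v : A) : (Some u == Some v) = (u == v) by [].
split; first by split.
split.
  case=> [u|]; rewrite EB /= ?eqxx //= !Sneq (eq_sym u (par b)) -/(par b == u).
  by have [->|ub] := eqVneq u b; rewrite ?br ?orbT ?andbF ?orbF //= andbF orbF.
split.
  by rewrite EB /= !eqxx (negbTE pb) /= !Sneq (negbTE pb) (negbTE pnb) !andbF.
split; first by move=> [u|] [v|] //= _ _ ->.
split; first by move=> c; exists (Some c).
split.
  move=> [u|] [v|] // _ _; rewrite EB rE_par /pedge !Sneq /=.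
  have [->|ub] := eqVneq u b; have [->|vb] := eqVneq v b; rewrite ?eqxx //=.
  - rewrite br /= (eq_sym v (par b)) -[Some (par v) == Some b]/(par v == b).
    by rewrite andbF orbC.
  - rewrite br /= (eq_sym u (par b)) -[Some (par u) == Some b]/(par u == b).
    by rewrite -[None == Some u]/false andbT !orbF -orbA.
  - by rewrite andbF !orbF.
split=> //; split; first by case: up; [right|left].
by split=> //; apply/tleP; apply: par_anc.
Qed.

End SplitExists.

Lemma sc_edge (A B : rtree) (f : A -> B) : sc f -> forall u v, rE A u v -> rE B (f u) (f v).
Proof.
elim=> {A B f} [A B f [x [a [b sp]]]|A B f [h _ _ _ _] _ _|A B C f g _ hf _ hg] u v //.
- exact: (split_edge sp).
- exact: h.
- by move=> /hf/hg.
Qed.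

Lemma sc_onto (A B : rtree) (f : A -> B) : sc f -> forall c, exists v, f v = c.
Proof.
elim=> {A B f} [A B f [x [a [b sp]]]|A B f [_ h _ _ _] _ _|A B C f g _ hf _ hg] c //.
- by have [u _ <-] := split_onto sp c; exists u.
- by have [v gv] := hg c; have [u fu] := hf v; exists u; rewrite /= fu.
Qed.

Lemma sc_id (A : rtree) : sc (@id A).
Proof.
apply: covering_sc; split=> // v c vc; by exists c.
Qed.

Section EdgeTree.

Let par0 (x : bool) := false.
Let par0_rk (x : bool) : x != false -> nat_of_bool (par0 x) < nat_of_bool x.
Proof. by case: x. Qed.
Let card2 : 1 < #|{: bool}|. Proof. by rewrite card_bool. Qed.

Definition edge_tree : rtree := parent_tree par0_rk card2.

Lemma edge_tree_child (v w : edge_tree) : child v w = ((v : bool) == false) && (w : bool).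
Proof.
rewrite /child; case: w => /=; last by rewrite andbF.
by rewrite parent_treeE // eq_sym andbT.
Qed.

End EdgeTree.

(** * Charts *)

Local Open Scope ring_scope.

Section Agree.
Variables (R : realType) (d : nat -> R).
Implicit Types (s : nat -> bool) (t : R).

(* Two points [(s, t)], [(s', t)] of the product of the Cantor set with an arc are the
   same point of the Mohler-Nikiel dendroid exactly when [agree t s s']. *)
Definition agree t s s' := forall i, s i != s' i -> t <= d i.
Definition sagree t s s' := forall i, s i != s' i -> t < d i.

Lemma agree_refl t s : agree t s s.
Proof. by move=> i; rewrite eqxx. Qed.

Lemma agree_sym t s s' : agree t s s' -> agree t s' s.
Proof. by move=> h i; rewrite eq_sym; apply: h. Qed.

Lemma agree_le t t' s s' : t <= t' -> agree t' s s' -> agree t s s'.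
Proof. by move=> tt h i /h; apply: le_trans. Qed.

Lemma agree_lt t t' s s' : t < t' -> agree t' s s' -> sagree t s s'.
Proof. by move=> tt h i /h; apply: lt_le_trans. Qed.

Lemma sagreeW t s s' : sagree t s s' -> agree t s s'.
Proof. by move=> h i /h/ltW. Qed.

Lemma sagree_le t t' s s' : t <= t' -> sagree t' s s' -> sagree t s s'.
Proof. by move=> tt h i /h; apply: le_lt_trans. Qed.

End Agree.

(* A chart reads the tree [A] off the dendroid: [thru v s] says that the arc of the dendroid
   with code [s] runs through [v], and [ht v s] is the height on that arc of the point
   standing for [v], at which the arcs leaving [v] towards different children separate.
   Only the first [N] bits of [s] matter. *)
Record chart (R : realType) (d : nat -> R) (A : rtree) (N : nat) := Chart {
  thru : A -> (nat -> bool) -> bool;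
  ht : A -> (nat -> bool) -> R;
  chart_loc : forall s s', (forall i, (i < N)%N -> s i = s' i) ->
    forall v, thru v s = thru v s' /\ ht v s = ht v s';
  thru_root : forall s, thru (rroot A) s;
  ht_root : forall s, ht (rroot A) s = 0;
  thru_child : forall v w s, child v w -> thru w s -> thru v s;
  ht_child : forall v w s, child v w -> thru w s -> ht v s < ht w s;
  thru_next : forall v w s, child v w -> thru v s -> exists2 w', child v w' & thru w' s;
  thru_uniq : forall v w w' s, child v w -> child v w' -> thru w s -> thru w' s -> w = w';
  ht_leaf : forall v s, (forall w, ~~ child v w) -> thru v s -> ht v s = 1;
  ht_node : forall v w s, child v w -> thru v s -> exists i, ht v s = d i;
  thru_sagree : forall v w s s', child v w -> thru w s -> sagree d (ht v s) s s' -> thru w s';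
  ht_agree : forall v s s', thru v s -> agree d (ht v s) s s' -> ht v s' = ht v s;
  thru_split : forall v w s, child v w -> thru v s ->
    exists2 s', agree d (ht v s) s s' & thru w s'
}.

(* The part of the dendroid over [v]: on each arc, the segment between the heights of the
   neighbours of [v]. *)
Definition cell (R : realType) (d : nat -> R) (A : rtree) (N : nat) (c : chart d A N)
    (v : A) (s : nat -> bool) (t : R) : Prop :=
  [/\ thru c v s, forall u, child u v -> ht c u s <= t
    & forall w, child v w -> thru c w s -> t <= ht c w s].

Section Chart.
Variables (R : realType) (d : nat -> R) (A : rtree) (N : nat) (c : chart d A N).
Hypothesis d01 : forall n, 0 <= d n < 1.
Implicit Types (u v w : A) (s : nat -> bool) (t : R).

Lemma thru_anc v w s : anc v w -> thru c w s -> thru c v s.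
Proof.
elim/par_ind: w => [/anc_toroot->//|w wr IH].
rewrite (anc_par _ wr) => /orP[/eqP->//|/IH h] /(thru_child (child_par wr)).
exact: h.
Qed.

Lemma ht_anc v w s : anc v w -> thru c w s -> ht c v s <= ht c w s.
Proof.
elim/par_ind: w => [/anc_toroot->//|w wr IH].
rewrite (anc_par _ wr) => /orP[/eqP->//|/IH h] tw.
have cw := child_par wr.
by apply: le_trans (ltW (ht_child cw tw)); apply: h; apply: thru_child tw.
Qed.

Lemma thru_total v w s : thru c v s -> thru c w s -> anc v w || anc w v.
Proof.
move=> tv tw; elim/par_ind: v tv => [_|v vr IH tv]; first by rewrite anc_root.
have cv := child_par vr; have /orP[h|h] := IH (thru_child cv tv); last first.
  by rewrite (anc_trans h (par_anc vr)) orbT.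
have [e|ne] := eqVneq (par v) w; first by rewrite -e (par_anc vr) orbT.
have [n cn nw] := anc_neq_child h ne.
by rewrite -(thru_uniq cn cv (thru_anc nw tw) tv) nw.
Qed.

(** The vertices on an arc form a chain, so one that is higher than [v] lies at or beyond the next
    vertex [w]. *)
Lemma ht_between u v w s : child v w -> thru c w s -> thru c u s ->
  ht c v s < ht c u s -> ht c w s <= ht c u s.
Proof.
move=> cw tw tu lt; have tv := thru_child cw tw.
have /orP[h|h] := thru_total tu tv.
  by move: (ht_anc h tv); rewrite leNgt lt.
have ne : v != u by apply: contraTneq lt => ->; rewrite ltxx.
have [n cn nu] := anc_neq_child h ne; have tn := thru_anc nu tu.
by rewrite (thru_uniq cw cn tw tn) ht_anc.
Qed.

Lemma thru_agree v s s' : thru c v s -> agree d (ht c v s) s s' -> thru c v s'.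
Proof.
have [->|vr] := eqVneq v (rroot A); first by rewrite !thru_root.
have cv := child_par vr.
move=> tv ag; apply: (thru_sagree cv tv); apply: agree_lt ag.
exact: ht_child cv tv.
Qed.

Lemma nodeVleaf v : (exists w, child v w) \/ (forall w, ~~ child v w).
Proof.
have [/existsP h|/existsPn h] := boolP [exists w, child v w]; first by left.
by right.
Qed.

Lemma ht_01 v s : thru c v s -> 0 <= ht c v s <= 1.
Proof.
move=> tv; have [[w cw]|lf] := nodeVleaf v.
  by have [i ->] := ht_node cw tv; have /andP[-> /ltW->] := d01 i.
by rewrite ht_leaf // lexx ler01.
Qed.

Lemma last_below s t : 0 <= t -> exists v, [/\ thru c v s, ht c v s <= t
  & forall w, child v w -> thru c w s -> t < ht c w s].
Proof.
move=> t0; pose Q v := thru c v s && (ht c v s <= t).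
have Q0 : Q (rroot A) by rewrite /Q thru_root ht_root.
case: (arg_maxnP (@depth A) Q0) => v /andP[tv hv] mx; exists v; split=> // w cw tw.
rewrite ltNge; apply/negP => le; have := mx w; rewrite /Q tw le => /(_ isT).
by rewrite (child_depth cw) /= ltnn.
Qed.

Lemma cell_cover s t : 0 <= t -> exists v, cell c v s t.
Proof.
move=> /(last_below s)[v [tv hv mx]]; exists v; split=> //.
  by move=> u cu; apply: le_trans hv; apply/ltW/ht_child.
by move=> w cw tw; apply/ltW/mx.
Qed.

Lemma thru_inhabited v : exists s, thru c v s.
Proof.
elim/par_ind: v => [|v vr [s ts]]; first by exists (fun=> false); apply: thru_root.
by have [s' _ h] := thru_split (child_par vr) ts; exists s'.
Qed.

Lemma cell_ht v s : thru c v s -> cell c v s (ht c v s).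
Proof.
by move=> tv; split=> // u cu => [|tu]; apply/ltW; [apply: ht_child|apply: ht_child].
Qed.

(** On an arc through both, the core of the parent lies in both cells. *)
Lemma cell_edge v w : rE A v w ->
  exists s t, [/\ 0 <= t <= 1, cell c v s t & cell c w s t].
Proof.
have aux u n : child u n -> exists s t, [/\ 0 <= t <= 1, cell c u s t & cell c n s t].
  move=> cn; have [s tn] := thru_inhabited n; exists s, (ht c u s).
  have tu := thru_child cn tn; have lt := ht_child cn tn.
  rewrite ht_01 //; split=> //; first exact: cell_ht.
  split=> // [m /childP[_ <-]|m cm tm]; first by case/childP: cn => _ ->.
  by apply: le_trans (ltW lt) _; apply/ltW/ht_child.
move=> /edgeP[<-|/aux//|/aux[s [t [? ? ?]]]]; last by exists s, t.
have [s tv] := thru_inhabited v; exists s, (ht c v s).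
by rewrite ht_01 //; have := cell_ht tv.
Qed.

(** A cell ends at the neighbouring cores. If [v] and [u] were two or more steps apart on the arc, a
    core strictly between them would put [t] outside the cell of [v]. *)
Lemma cell_near_below v u s t : cell c v s t -> thru c u s -> ht c u s <= t ->
  (forall w, child u w -> thru c w s -> t < ht c w s) -> rE A v u.
Proof.
move=> [tv lo hi] tu hu mx; have /orP[h|h] := thru_total tv tu.
  have [->|ne] := eqVneq v u; first exact: rE_refl.
  have [n cn nu] := anc_neq_child h ne; have tn := thru_anc nu tu.
  have [<-|ne'] := eqVneq n u; first exact: child_edge.
  have [m cm mu] := anc_neq_child nu ne'; have tm := thru_anc mu tu.
  have := le_trans (le_trans (ht_anc mu tu) hu) (hi _ cn tn).
  by rewrite leNgt ht_child.
have [->|ne] := eqVneq u v; first exact: rE_refl.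
have [n cn nv] := anc_neq_child h ne; have tn := thru_anc nv tv.
have [<-|ne'] := eqVneq n v; first by rewrite rE_sym child_edge.
have vr : v != rroot A.
  by apply: contraNneq ne' => vr; move: nv; rewrite vr => /anc_toroot->.
have cv := child_par vr; have pn : anc n (par v).
  by move: nv; rewrite (anc_child _ cv) (negbTE ne').
have := le_lt_trans (le_trans (ht_anc pn (thru_child cv tv)) (lo _ cv)) (mx _ cn tn).
by rewrite ltxx.
Qed.

(* Both vertices are adjacent to the last vertex below height [t], which the two arcs share. *)
Lemma cell_near v w s s' t : 0 <= t -> agree d t s s' -> cell c v s t -> cell c w s' t ->
  exists2 u, rE A v u & rE A u w.
Proof.
move=> t0 ag cv cw; have [u [tu hu mx]] := last_below s t0.
have ag' := agree_le hu ag; have hu' := ht_agree tu ag'; have tu' := thru_agree tu ag'.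
exists u; first exact: cell_near_below cv tu hu mx.
rewrite rE_sym; apply: cell_near_below cw tu' _ _; first by rewrite hu'.
move=> n cn tn; rewrite ltNge; apply/negP => le.
have ags := agree_sym (agree_le le ag).
have := mx _ cn; rewrite (thru_agree tn) // -?(ht_agree tn) // => /(_ isT).
by rewrite (ht_agree tn) // ltNge le.
Qed.

End Chart.

Definition refines (R : realType) (d : nat -> R) (B A : rtree) (g : B -> A) (M N : nat)
    (c' : chart d B M) (c : chart d A N) : Prop :=
  forall v s t, cell c' v s t -> cell c (g v) s t.

Lemma refines_comp (R : realType) (d : nat -> R) (C B A : rtree) (f : C -> B) (g : B -> A)
    (L M N : nat) (c2 : chart d C L) (c1 : chart d B M) (c0 : chart d A N) :
  refines f c2 c1 -> refines g c1 c0 -> refines (g \o f) c2 c0.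
Proof. by move=> h1 h2 v s t /h1/h2. Qed.

(** * Lifting charts *)

Section SplitChart.
Variables (R : realType) (d : nat -> R) (B A : rtree) (f : B -> A) (x a b : B).
Variables (N : nat) (c : chart d A N) (k : nat).
Hypothesis d01 : forall n, 0 <= d n < 1.
Hypothesis d_dense : forall p q : R, 0 <= p -> p < q -> q <= 1 -> exists n, p < d n < q.
Hypothesis sp : split_at f x a b.

Let ha s := ht c (f a) s.
Let hb s := ht c (f b) s.
Let low s := \big[Order.max/ha s]_(i < N | d i < hb s) d i.

Let fab := split_old_edge sp.

Let ha_hb s : thru c (f b) s -> ha s < hb s.
Proof. exact: ht_child. Qed.

Let hb_le1 s : thru c (f b) s -> hb s <= 1.
Proof. by move=> /(ht_01 d01)/andP[]. Qed.

Let ha_ge0 s : thru c (f b) s -> 0 <= ha s.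
Proof. by move=> /(thru_child fab)/(ht_01 d01)/andP[]. Qed.

Let low_ge s : ha s <= low s.
Proof. exact: bigmax_ge_id. Qed.

Let low_lt s : thru c (f b) s -> low s < hb s.
Proof. by move=> /ha_hb h; apply/bigmax_ltP; split. Qed.

Let bit_low s i : (i < N)%N -> d i < hb s -> d i <= low s.
Proof. by move=> iN h; apply: (bigmax_sup (Ordinal iN)). Qed.

Let split_childP v w : child v w -> [\/ v = a /\ w = x, v = x /\ w = b |
  [/\ v != x, w != x, w != b & child (f v) (f w)]].
Proof.
move=> cw; have [vx|vx] := eqVneq v x.
  by constructor 2; split=> //; apply: (split_child_x sp); rewrite -vx.
by have [?|[? ? ?]] := split_child_old sp vx cw; [constructor 1|constructor 3].
Qed.

(* When [d k] cannot be used, the new height is taken above every [d i < hb s] with [i < N],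
   so that two arcs agreeing up to it also agree up to [hb s]. *)
Lemma chart_split : exists c' : chart d B N,
  [/\ refines f c' c,
      forall v s, v != x -> thru c' v s = thru c (f v) s /\ ht c' v s = ht c (f v) s,
      forall s, thru c' x s = thru c (f b) s
    & forall s, thru c (f b) s ->
        ~~ (ha s < d k < ht c' x s) /\ ~~ (ht c' x s < d k < hb s)].
Proof.
have /choice[pick pickP] : forall pq : R * R, exists n,
    0 <= pq.1 -> pq.1 < pq.2 -> pq.2 <= 1 -> pq.1 < d n < pq.2.
  move=> [p q] /=.
  have [/and3P[h1 h2 h3]|h] := boolP [&& 0 <= p, p < q & q <= 1].
    by have [n ?] := d_dense h1 h2 h3; exists n.
  by exists 0%N => h1 h2 h3; rewrite h1 h2 h3 in h.
(* Wherever [d k] fits between the two cores it becomes the core of [x], which is how [add_height]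
   inserts a prescribed height; elsewhere density supplies one. *)
pose ix s := if ha s < d k < hb s then k else pick (low s, hb s).
pose hx s := d (ix s).
have hxP s : thru c (f b) s -> ha s < hx s < hb s.
  move=> tb; rewrite /hx /ix; case: ifP => // _.
  have := pickP (low s, hb s) (le_trans (ha_ge0 tb) (low_ge s)) (low_lt tb) (hb_le1 tb).
  by move=> /andP[h1 ->]; rewrite (le_lt_trans (low_ge s)).
have hx_loc s s' : (forall i, (i < N)%N -> s i = s' i) -> hx s = hx s'.
  move=> e; have [_ ea] := chart_loc c e (f a); have [_ eb] := chart_loc c e (f b).
  by rewrite /hx /ix /low /ha /hb ea eb.
(* Bits from [N] on do not influence [hx], so [s'] is replaced by a code that differs from [s] only
   in the first [N] bits. If [d k] is in use, [hb s'] cannot drop to [d k], for then the codes would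
   agree up to [hb s'] and [hb] would be the same on both; otherwise they agree up to [hb s] by the
   choice of [low]. *)
have hx_agree s s' : thru c (f b) s -> agree d (hx s) s s' -> hx s' = hx s.
  move=> tb ag; pose s2 i := if (i < N)%N then s' i else s i.
  have {ag} : agree d (hx s) s s2.
    by move=> i; rewrite /s2; case: ifP => _; [apply: ag|rewrite eqxx].
  have -> : hx s' = hx s2 by apply: hx_loc => i iN; rewrite /s2 iN.
  have : forall i, (N <= i)%N -> s i = s2 i by move=> i; rewrite /s2 ltnNge => ->.
  move: s2 => {}s' far ag; have /andP[lo hi] := hxP _ tb.
  have ta := thru_child fab tb.
  have tb' := thru_sagree fab tb (agree_lt lo ag).
  have ea : ha s' = ha s := ht_agree ta (agree_le (ltW lo) ag).
  move: ag lo hi; rewrite /hx; rewrite {1 2 3 5}/ix; case: ifP => cs ag lo hi.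
    rewrite /ix ea lo /= ltNge; case: leP => [le|//].
    have := ht_agree tb' (agree_sym (agree_le le ag)); rewrite -/(hb _) -/(hb _) => eb.
    by move: hi; rewrite eb ltNge le.
  have ag' : agree d (hb s) s s'.
    move=> i ne; rewrite leNgt; apply/negP => lt.
    have iN : (i < N)%N by rewrite ltnNge; apply: contra ne => /far->.
    have /andP[h _] := pickP (low s, hb s) (le_trans (ha_ge0 tb) (low_ge s)) (low_lt tb) (hb_le1 tb).
    by have := le_lt_trans (bit_low iN lt) (lt_le_trans h (ag _ ne)); rewrite ltxx.
  have eb : hb s' = hb s := ht_agree tb ag'.
  by rewrite /ix /low ea eb cs.
pose T v s := if v == x then thru c (f b) s else thru c (f v) s.
pose H v s := if v == x then hx s else ht c (f v) s.
have [_ ax bx _] := split_neq sp.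
have xr : x != rroot B by case: (split_neq sp).
have Tx s : T x s = thru c (f b) s by rewrite /T eqxx.
have Hx s : H x s = hx s by rewrite /H eqxx.
have To v s : v != x -> T v s = thru c (f v) s by rewrite /T => /negbTE->.
have Ho v s : v != x -> H v s = ht c (f v) s by rewrite /H => /negbTE->.
have c_ax := split_child_ax sp; have c_xb := split_child_xb sp.
have Tloc s s' : (forall i, (i < N)%N -> s i = s' i) ->
    forall v, T v s = T v s' /\ H v s = H v s'.
  move=> e v; rewrite /T /H (hx_loc _ _ e); have [-> _] := chart_loc c e (f b).
  by have [-> ->] := chart_loc c e (f v).
have Troot s : T (rroot B) s by rewrite To ?(split_root sp) ?thru_root // eq_sym.
have Hroot s : H (rroot B) s = 0 by rewrite Ho ?(split_root sp) ?ht_root // eq_sym.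
have Tchild v w s : child v w -> T w s -> T v s.
  move=> /split_childP[[-> ->]|[-> ->]|[vx wx wb cf]].
  - by rewrite Tx To //; apply: thru_child.
  - by rewrite Tx To.
  - by rewrite !To //; apply: thru_child.
have Hchild v w s : child v w -> T w s -> H v s < H w s.
  move=> /split_childP[[-> ->]|[-> ->]|[vx wx wb cf]].
  - by rewrite Tx Hx Ho // => /hxP/andP[].
  - by rewrite To // Hx Ho // => /hxP/andP[].
  - by rewrite !To // !Ho //; apply: ht_child.
have child_f v w : v != x -> child v w -> exists n, child (f v) n.
  move=> vx /split_childP[[-> _]|[e _]|[_ _ _ cf]]; [by exists (f b)| |by exists (f w)].
  by rewrite e eqxx in vx.
have Tnext v w s : child v w -> T v s -> exists2 w', child v w' & T w' s.
  have [->|vx] := eqVneq v x; first by move=> _; rewrite Tx; exists b; rewrite // To.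
  move=> /(child_f _ _ vx)[n cn]; rewrite To // => /(thru_next cn)[n' cn' tn'].
  have [[va e]|[w' [cw' wx wb e]]] := split_lift_child sp vx cn'.
    by exists x; rewrite ?va // Tx -e.
  by exists w' => //; rewrite To // e.
have Tuniq v w w' s : child v w -> child v w' -> T w s -> T w' s -> w = w'.
  move=> cw cw'; have [vx|vx] := eqVneq v x.
    by rewrite vx in cw cw'; rewrite (split_child_x sp cw) (split_child_x sp cw').
  have [[va ->]|[wx wb cf]] := split_child_old sp vx cw;
    have [[va' ->]|[wx' wb' cf']] := split_child_old sp vx cw' => //.
  - rewrite Tx To // => t1 t2; have := thru_uniq _ cf' t1 t2; rewrite va => /(_ fab).
    by move=> /(split_inj sp bx wx') e; rewrite e eqxx in wb'.
  - rewrite Tx To // => t1 t2; have := thru_uniq cf _ t1 t2; rewrite va' => /(_ fab).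
    by move=> /(split_inj sp wx bx) e; rewrite e eqxx in wb.
  - by rewrite !To // => t1 t2; apply: (split_inj sp wx wx'); apply: thru_uniq cf cf' t1 t2.
have Hleaf v s : (forall w, ~~ child v w) -> T v s -> H v s = 1.
  move=> lf; have vx : v != x by apply/eqP => e; move: (lf b); rewrite e c_xb.
  rewrite To // Ho //; apply: ht_leaf => n; apply/negP => cn.
  have [[va _]|[w [cw _ _ _]]] := split_lift_child sp vx cn.
    by move: (lf x); rewrite va c_ax.
  by move: (lf w); rewrite cw.
have Hnode v w s : child v w -> T v s -> exists i, H v s = d i.
  have [->|vx] := eqVneq v x; first by exists (ix s); rewrite Hx.
  by move=> /(child_f _ _ vx)[n cn]; rewrite To // Ho // => /(ht_node cn).
have Tsagree v w s s' : child v w -> T w s -> sagree d (H v s) s s' -> T w s'.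
  move=> /split_childP[[-> ->]|[-> ->]|[vx wx wb cf]].
  - by rewrite !Tx Ho //; apply: thru_sagree.
  - rewrite Hx !To // => tb ag; apply: (thru_sagree fab tb).
    by apply: sagree_le ag; case/andP: (hxP _ tb) => /ltW.
  - by rewrite !To // Ho //; apply: thru_sagree.
have Hagree v s s' : T v s -> agree d (H v s) s s' -> H v s' = H v s.
  have [->|vx] := eqVneq v x; first by rewrite Tx !Hx; apply: hx_agree.
  by rewrite To // !Ho //; apply: ht_agree.
have Tsplit v w s : child v w -> T v s -> exists2 s', agree d (H v s) s s' & T w s'.
  move=> /split_childP[[-> ->]|[-> ->]|[vx wx wb cf]].
  - by rewrite To // Ho // => /(thru_split fab)[s' ag t']; exists s'; rewrite // Tx.
  - by rewrite Tx => tb; exists s; rewrite ?To //; apply: agree_refl.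
  - by rewrite To // Ho // => /(thru_split cf)[s' ag t']; exists s'; rewrite // To.
exists (Chart Tloc Troot Hroot Tchild Hchild Tnext Tuniq Hleaf Hnode Tsagree Hagree Tsplit).
split=> //=; first last.
- move=> s tb; rewrite Hx /hx /ix; case: ifP => [_|]; first by rewrite !ltxx andbF.
  have /andP[lo hi] := hxP _ tb; move: lo hi; rewrite /hx /ix.
  case: ifP => // cs lo hi _; split; apply/negP => /andP[h1 h2].
    by move: cs; rewrite h1 (lt_trans h2 hi).
  by move: cs; rewrite h2 (lt_trans lo h1).
- by move=> v s vx; rewrite To // Ho.
move=> v s t [/= tv lo hi]; have [vx|vx] := eqVneq v x.
  rewrite vx Tx in tv; have ta := thru_child fab tv.
  have lo' := lo a; rewrite vx Ho // in lo'; have {}lo' := lo' c_ax.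
  have hi' := hi b; rewrite vx Ho // To // in hi'; have {}hi' := hi' c_xb tv.
  rewrite vx; case: (split_new sp) => ->; split=> //.
  - by move=> u cu; apply: le_trans lo'; apply/ltW/ht_child.
  - by move=> w cw tw; rewrite (thru_uniq cw fab tw tv).
  - by move=> u /childP[_ <-]; case/childP: fab => _ ->.
  - by move=> w cw tw; apply: le_trans hi' _; apply/ltW/ht_child.
rewrite To // in tv; split=> //.
- move=> u /childP[fr <-].
  have vr : v != rroot B by apply: contra fr => /eqP->; rewrite (split_root sp).
  have [vb|vb] := eqVneq v b.
    have := lo x; rewrite vb Hx => /(_ c_xb); apply: le_trans.
    case/childP: fab => _ ->; rewrite vb in tv; by case/andP: (hxP _ tv) => /ltW.
  have [px <-] := split_par sp vx vb vr.
  by rewrite -Ho //; apply: lo; apply: child_par.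
move=> n cn tn; have [[va e]|[w [cw wx wb e]]] := split_lift_child sp vx cn.
  have := hi x; rewrite va e in tn *; rewrite Tx Hx => /(_ c_ax tn) h.
  by apply: le_trans h _; case/andP: (hxP _ tn) => _ /ltW.
by rewrite -e -Ho //; apply: hi => //; rewrite To // e.
Qed.

End SplitChart.

Section LiftChart.
Variables (R : realType) (d : nat -> R) (B A : rtree) (g : B -> A).
Variables (N M : nat) (c : chart d A N) (T : B -> (nat -> bool) -> bool).
Hypothesis cg : covering g.
Hypothesis NM : (N <= M)%N.
Hypothesis Tloc : forall s s', (forall i, (i < M)%N -> s i = s' i) ->
  forall v, T v s = T v s'.
Hypothesis Troot : forall s, T (rroot B) s.
Hypothesis Tchild : forall v w s, child v w -> T w s -> T v s.
Hypothesis Tthru : forall v s, T v s -> thru c (g v) s.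
Hypothesis Tlift : forall v n s, T v s -> child (g v) n -> thru c n s ->
  exists w, [/\ child v w, g w = n & T w s].
Hypothesis Tuniq : forall v w w' s, child v w -> child v w' -> g w = g w' ->
  T w s -> T w' s -> w = w'.
Hypothesis Tsagree : forall v w s s', child v w -> T w s ->
  sagree d (ht c (g v) s) s s' -> T w s'.
Hypothesis Tsplit : forall v w s, child v w -> T v s ->
  exists2 s', agree d (ht c (g v) s) s s' & T w s'.

(** Heights are pulled back along [g], so a lift is determined by the choice [T] of the arcs through
    each vertex. This serves [chart_covering], where [g] is given, and [separate], where [g] is
    constructed. *)
Lemma chart_lift : exists c' : chart d B M,
  [/\ refines g c' c, forall v s, thru c' v s = T v s
    & forall v s, ht c' v s = ht c (g v) s].
Proof.
have [g0 gp gl] := cg.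
pose H v s := ht c (g v) s.
have Tloc' s s' : (forall i, (i < M)%N -> s i = s' i) ->
    forall v, T v s = T v s' /\ H v s = H v s'.
  move=> e v; split; first exact: Tloc.
  by apply: (chart_loc c _ _).2 => i iN; apply: e; apply: leq_trans NM.
have Hroot s : H (rroot B) s = 0 by rewrite /H g0 ht_root.
have cc v w : child v w -> child (g v) (g w) by apply: covering_child.
have Hchild v w s : child v w -> T w s -> H v s < H w s.
  by move=> /cc cw /Tthru; apply: ht_child.
have Tnext v w s : child v w -> T v s -> exists2 w', child v w' & T w' s.
  move=> /cc cw tv; have [n cn tn] := thru_next cw (Tthru tv).
  by have [w' [? _ ?]] := Tlift tv cn tn; exists w'.
have Tuniq' v w w' s : child v w -> child v w' -> T w s -> T w' s -> w = w'.
  move=> cw cw' t t'; apply: (Tuniq cw cw' _ t t').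
  exact: thru_uniq (cc _ _ cw) (cc _ _ cw') (Tthru t) (Tthru t').
have Hleaf v s : (forall w, ~~ child v w) -> T v s -> H v s = 1.
  move=> lf /Tthru; apply: ht_leaf => n; apply/negP => /gl[w cw _].
  by move: (lf w); rewrite cw.
have Hnode v w s : child v w -> T v s -> exists i, H v s = d i.
  by move=> /cc cw /Tthru; apply: ht_node cw.
have Hagree v s s' : T v s -> agree d (H v s) s s' -> H v s' = H v s.
  by move=> /Tthru; apply: ht_agree.
exists (Chart Tloc' Troot Hroot Tchild Hchild Tnext Tuniq' Hleaf Hnode Tsagree Hagree Tsplit).
split=> // v s t [/= tv lo hi]; split; first exact: Tthru.
- move=> u /childP[fr <-].
  have vr : v != rroot B by apply: contra fr => /eqP->; rewrite g0.
  by have [_ <-] := gp _ vr; apply: lo; apply: child_par.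
- by move=> n cn tn; have [w [cw <- tw]] := Tlift tv cn tn; apply: hi.
Qed.

End LiftChart.

Lemma uniform_bound (I : finType) (Q : I -> nat -> Prop) :
  (forall i n m, (n <= m)%N -> Q i n -> Q i m) -> (forall i, exists n, Q i n) ->
  exists n, forall i, Q i n.
Proof.
move=> mono /choice[b bP]; exists (\max_i b i)%N => i.
by apply: mono (bP i); apply: leq_bigmax.
Qed.

Lemma bits_bound (N : nat) (Q : (nat -> bool) -> nat -> Prop) :
  (forall s n m, (n <= m)%N -> Q s n -> Q s m) ->
  (forall s s' n, (forall i, (i < N)%N -> s i = s' i) -> Q s n -> Q s' n) ->
  (forall s, exists n, Q s n) -> exists n, forall s, Q s n.
Proof.
move=> mono loc ex.
pose ext (x : {ffun 'I_N -> bool}) i := if insub i is Some j then x j else false.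
have [n nP] := uniform_bound (fun x => @mono (ext x)) (fun x => ex (ext x)).
exists n => s; apply: loc (nP [ffun i : 'I_N => s i]) => i iN.
by rewrite /ext insubT ffunE.
Qed.

Section FreshBits.
Variables (R : realType) (d : nat -> R) (N : nat).
Hypothesis d_inf : forall n K, exists m, (K < m)%N /\ d m = d n.

Definition fresh M (e : R) := [seq j <- iota 0 M | (N <= j)%N && (d j == e)].

Lemma mem_fresh M e j : (j \in fresh M e) = [&& (N <= j)%N, d j == e & (j < M)%N].
Proof. by rewrite mem_filter mem_iota /= add0n -andbA. Qed.

Lemma fresh_size_le M M' e : (M <= M')%N -> (size (fresh M e) <= size (fresh M' e))%N.
Proof.
move=> MM'; apply: uniq_leq_size; first by rewrite filter_uniq ?iota_uniq.
by move=> j; rewrite !mem_fresh => /and3P[-> -> /leq_trans->].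
Qed.

Lemma fresh_large i L : exists M, (L <= size (fresh M (d i)))%N.
Proof.
elim: L => [|L [M h]]; first by exists 0%N.
have [j [lt dj]] := d_inf i (maxn N M).
exists j.+1; apply: leq_ltn_trans h _.
have jN : (N <= j)%N by apply: leq_trans (ltnW lt); apply: leq_maxl.
have jM : (M <= j)%N by apply: leq_trans (ltnW lt); apply: leq_maxr.
rewrite {2}/fresh -[j.+1]addn1 iotaD filter_cat size_cat /= add0n jN dj eqxx /= addn1 ltnS.
exact: fresh_size_le.
Qed.

End FreshBits.

Section CoverChart.
Variables (R : realType) (d : nat -> R) (B A : rtree) (g : B -> A).
Variables (N : nat) (c : chart d A N).
Hypothesis d_inf : forall n K, exists m, (K < m)%N /\ d m = d n.
Hypothesis cg : covering g.

Let kids v n := [seq w <- enum B | child v w && (g w == n)].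

Let mem_kids v n w : (w \in kids v n) = child v w && (g w == n).
Proof. by rewrite mem_filter mem_enum andbT. Qed.

Let kids_uniq v n : uniq (kids v n).
Proof. by rewrite filter_uniq ?enum_uniq. Qed.

Let kids_size v n : (size (kids v n) <= #|B|)%N.
Proof. by rewrite cardE size_filter count_size. Qed.

(** The default makes every arc choose exactly one lift: child number 0 is taken whenever [find]
    runs past the list of children. *)
Let pos k i := if (i < k)%N then i else 0%N.

(* At a vertex [v], the first bit equal to [true] among many unused bits of height exactly
   [ht c (g v) s] decides which lift of the next vertex the arc [s] takes. *)
Lemma chart_covering : exists M (c' : chart d B M), refines g c' c.
Proof.
(* There are finitely many vertices and words to serve, and [#|B|] bounds the number of lifts of one
   vertex. *)
have [M0 M0P] : exists M, forall s v n, child v n -> thru c v s ->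
    (#|B| <= size (fresh d N M (ht c v s)))%N.
  apply: (@bits_bound N).
  - by move=> s n m nm h v w cw tv; apply: leq_trans (h v w cw tv) _; apply: fresh_size_le.
  - move=> s s' n e h v w cw; have [-> ->] := chart_loc c (fun i iN => esym (e i iN)) v.
    exact: h cw.
  move=> s; pose Q v n := forall w, child v w -> thru c v s ->
    (#|B| <= size (fresh d N n (ht c v s)))%N.
  have [||n nP] := @uniform_bound A Q; last by exists n => v w; apply: nP.
    by move=> v n m nm h w cw tv; apply: leq_trans (h w cw tv) _; apply: fresh_size_le.
  move=> v; have [[w cw]|lf] := nodeVleaf v; last first.
    by exists 0%N => w cw; move: (lf w); rewrite cw.
  have [tv|tv] := boolP (thru c v s); last by exists 0%N => w' _ tv'; rewrite tv' in tv.
  have [i e] := ht_node cw tv; have [n nP] := fresh_large N d_inf i #|B|.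
  by exists n => w' _ _; rewrite e.
pose M := maxn N M0; have NM : (N <= M)%N := leq_maxl _ _.
have MP v n s : child v n -> thru c v s -> (#|B| <= size (fresh d N M (ht c v s)))%N.
  by move=> cn tv; apply: leq_trans (M0P s v n cn tv) _; apply: fresh_size_le; apply: leq_maxr.
pose J v s := fresh d N M (ht c (g v) s).
pose ok u s := thru c (g u) s &&
  (index u (kids (par u) (g u)) == pos (size (kids (par u) (g u))) (find s (J (par u) s))).
pose T w s := [forall u, (anc u w && (u != rroot B)) ==> ok u s].
have [g0 gp gl] := cg.
have Troot s : T (rroot B) s.
  by apply/forallP => u; apply/implyP => /andP[/anc_toroot->]; rewrite eqxx.
have Tc v w s : child v w -> T w s = T v s && ok w s.
  move=> cw; apply/forallP/andP => [h|[/forallP h okw] u].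
    split; last by apply: (implyP (h w)); rewrite anc_refl; case/childP: cw.
    apply/forallP => u; apply/implyP => /andP[uv ur]; apply: (implyP (h u)).
    by rewrite (anc_child _ cw) uv orbT.
  apply/implyP; rewrite (anc_child _ cw) => /andP[/orP[/eqP->//|uv] ur].
  by apply: (implyP (h u)); rewrite uv.
have Tchild v w s : child v w -> T w s -> T v s by move=> /Tc-> /andP[].
have Tthru v s : T v s -> thru c (g v) s.
  have [->|vr] := eqVneq v (rroot B); first by rewrite g0 thru_root.
  by rewrite (Tc _ _ _ (child_par vr)) => /andP[_ /andP[]].
have cc v w : child v w -> child (g v) (g w) by apply: covering_child.
have Tloc s s' : (forall i, (i < M)%N -> s i = s' i) -> forall v, T v s = T v s'.
  move=> e v; apply: eq_forallb => u; congr (_ ==> _).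
  have e' i : (i < N)%N -> s i = s' i by move=> iN; apply: e; apply: leq_trans NM.
  rewrite /ok /J; have [-> _] := chart_loc c e' (g u).
  have [_ ->] := chart_loc c e' (g (par u)); congr (_ && (_ == pos _ _)).
  by apply: eq_in_find => j; rewrite mem_fresh => /and3P[_ _ /e].
have Tlift v n s : T v s -> child (g v) n -> thru c n s ->
    exists w, [/\ child v w, g w = n & T w s].
  move=> tv cn tn; pose K := kids v n; pose i := pos (size K) (find s (J v s)).
  have iK : (i < size K)%N.
    rewrite /i /pos; case: ifP => // _; have [w cw gw] := gl _ _ cn.
    have : w \in K by rewrite mem_kids cw gw eqxx.
    by rewrite lt0n size_eq0; apply: contraTneq => ->.
  have := mem_nth v iK; rewrite mem_kids => /andP[cw /eqP gw].
  exists (nth v K i); split=> //; rewrite (Tc _ _ _ cw) tv /ok gw tn /=.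
  by case/childP: cw => _ ->; rewrite -/K index_uniq //; apply: kids_uniq.
have Tuniq v w w' s : child v w -> child v w' -> g w = g w' -> T w s -> T w' s -> w = w'.
  move=> cw cw' gw; rewrite (Tc _ _ _ cw) (Tc _ _ _ cw') => /andP[_ /andP[_ /eqP iw]].
  case/andP=> _ /andP[_ /eqP]; case/childP: (cw) (cw') => _ pw /childP[_ pw'].
  rewrite pw' -gw -pw -iw => iw'.
  have wK : w \in kids (par w) (g w) by rewrite mem_kids pw cw eqxx.
  have wK' : w' \in kids (par w) (g w) by rewrite mem_kids pw cw' gw eqxx.
  by rewrite -(nth_index w wK) -iw' nth_index.
have Tsagree v w s s' : child v w -> T w s -> sagree d (ht c (g v) s) s s' -> T w s'.
  move=> cw tw ag; apply/forallP => u; apply/implyP => /andP[uw ur].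
  have tgv := Tthru _ _ (Tchild _ _ _ cw tw).
  have cu := child_par ur; have := forallP tw u; rewrite uw ur /= => /andP[tu /eqP iu].
  have pv : anc (g (par u)) (g v).
    apply: covering_anc => //; move: uw; rewrite (anc_child _ cw) => /orP[/eqP->|].
      by case/childP: cw => _ ->; apply: anc_refl.
    by apply: anc_trans; apply: par_anc.
  have ag' := sagree_le (ht_anc pv tgv) ag.
  have tpu := thru_anc pv tgv; have ep := ht_agree tpu (sagreeW ag').
  rewrite /ok (thru_sagree (cc _ _ cu) tu ag') iu /J ep /=; apply/eqP; congr pos.
  (* A fresh bit consulted at [par u] has exactly the height of the core there, so strict agreement
     fixes it. *)
  apply: eq_in_find => j; rewrite mem_fresh => /and3P[_ /eqP dj _].
  by apply/eqP; apply: contraT => /ag'; rewrite dj ltxx.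
have Tsplit v w s : child v w -> T v s ->
    exists2 s', agree d (ht c (g v) s) s s' & T w s'.
  move=> cw tv; have tgv := Tthru _ _ tv.
  have [s1 ag1 t1] := thru_split (cc _ _ cw) tgv.
  (* The code [s1] reaches [g w]. Resetting the fresh bits so that the only true one has position
     [index w K] selects [w]; their height is exactly that of the core of [g v], so agreement is
     kept. *)
  pose K := kids v (g w); pose j0 := nth 0%N (J v s) (index w K).
  pose s2 j := if (j < N)%N then s1 j else if j \in J v s then j == j0 else s j.
  have ag2 : agree d (ht c (g v) s) s s2.
    move=> j; rewrite /s2; case: ifP => _; first exact: ag1.
    by case: ifP => [|_]; [rewrite mem_fresh => /and3P[_ /eqP->]|rewrite eqxx].
  have wK : w \in K by rewrite mem_kids cw eqxx.
  have iK : (index w K < size K)%N by rewrite index_mem.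
  have iJ : (index w K < size (J v s))%N.
    apply: leq_trans iK (leq_trans (kids_size _ _) _).
    exact: MP (cc _ _ cw) tgv.
  exists s2 => //; rewrite (Tc _ _ _ cw); apply/andP; split.
    have [->|vr] := eqVneq v (rroot B); first exact: Troot.
    have cv := child_par vr; apply: (Tsagree _ _ _ _ cv tv).
    by apply: agree_lt ag2; exact: ht_child (cc _ _ cv) tgv.
  have e12 i : (i < N)%N -> s2 i = s1 i by rewrite /s2 => ->.
  rewrite /ok; have [-> _] := chart_loc c e12 (g w); rewrite t1 /=.
  case/childP: (cw) => _ ->; rewrite -/K /J (ht_agree tgv ag2) -/(J v s).
  suff -> : find s2 (J v s) = index w K by rewrite /pos iK.
  rewrite -[RHS](index_uniq 0%N iJ) -/j0; last by rewrite filter_uniq ?iota_uniq.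
  apply: eq_in_find => j jJ; rewrite /s2 jJ ltnNge.
  by move: jJ; rewrite mem_fresh => /and3P[-> _ _].
have [c' [h _ _]] := chart_lift cg NM Tloc Troot Tchild Tthru Tlift Tuniq Tsagree Tsplit.
by exists M, c'.
Qed.

End CoverChart.

Lemma chart_sc (R : realType) (d : nat -> R) (B A : rtree) (f : B -> A) :
  (forall n, 0 <= d n < 1) ->
  (forall p q : R, 0 <= p -> p < q -> q <= 1 -> exists n, p < d n < q) ->
  (forall n K, exists m, (K < m)%N /\ d m = d n) ->
  sc f -> forall N (c : chart d A N), exists M (c' : chart d B M), refines f c' c.
Proof.
move=> d01 d_dense d_inf.
elim=> {B A f} [B A f [x [a [b sp]]]|B A f ef lf cf|C B A f g _ hf _ hg] N c.
(* The index 0 is an arbitrary preferred height. *)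
- by have [c' [h _ _ _]] := chart_split c 0 d01 d_dense sp; exists N, c'.
- exact: chart_covering (lce_covering ef lf cf).
- have [M [c1 r1]] := hg _ c; have [L [c2 r2]] := hf _ c1.
  by exists L, c2; apply: refines_comp r2 r1.
Qed.

(** * Refining charts *)

Section Mesh.
Variables (R : realType) (d : nat -> R).
Hypothesis d01 : forall n, 0 <= d n < 1.
Hypothesis d_dense : forall p q : R, 0 <= p -> p < q -> q <= 1 -> exists n, p < d n < q.

Definition has_height (A : rtree) N (c : chart d A N) (e : R) : Prop :=
  forall s, exists2 v, thru c v s & ht c v s = e.

Definition separated (A : rtree) N (c : chart d A N) : Prop :=
  forall v s s', thru c v s -> thru c v s' ->
  forall i, (i < N)%N -> s i != s' i -> ht c v s <= d i.

(** The mesh of a chart, tested with the first [n] values. A cell extends to both sides of its core,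
    so it may straddle one value and may hold arcs that have parted at the core itself; hence each
    clause leaves room for a second value [d j] above [d i]. *)
Definition small n (A : rtree) N (c : chart d A N) : Prop :=
  forall v s s' t t', cell c v s t -> cell c v s' t' ->
  forall i j, (i < n)%N -> (j < n)%N -> d i < d j ->
  ~~ ((t < d i) && (d j < t')) /\ (s i != s' i -> t <= d j).

Lemma small_refines n (B A : rtree) (g : B -> A) M N (c' : chart d B M) (c : chart d A N) :
  refines g c' c -> small n c -> small n c'.
Proof. by move=> r sm v s s' t t' /r h /r h'; apply: sm h h'. Qed.

Lemma separated_ht (A : rtree) N (c : chart d A N) v s s' : thru c v s ->
  (forall i, (i < N)%N -> s i != s' i -> ht c v s <= d i) ->
  thru c v s' /\ ht c v s' = ht c v s.
Proof.
move=> tv ag; pose s2 i := if (i < N)%N then s' i else s i.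
have e i : (i < N)%N -> s' i = s2 i by rewrite /s2 => ->.
have ag2 : agree d (ht c v s) s s2.
  by move=> i; rewrite /s2; case: ifP => [/ag//|_]; rewrite eqxx.
have [-> ->] := chart_loc c e v.
by rewrite (thru_agree tv ag2) (ht_agree tv ag2).
Qed.

Lemma has_height_between (A : rtree) N (c : chart d A N) e v w s : has_height c e ->
  child v w -> thru c w s -> ht c v s < e -> ht c w s <= e.
Proof. by move=> /(_ s)[u tu <-] cw tw; apply: ht_between. Qed.

Lemma cell_above (A : rtree) N (c : chart d A N) e v s t : has_height c e -> e < 1 ->
  cell c v s t -> ht c v s < e -> t <= e.
Proof.
move=> he e1 [tv _ hi] lt; have [[w cw]|lf] := nodeVleaf v.
  have [n cn tn] := thru_next cw tv.
  exact: le_trans (hi _ cn tn) (has_height_between he cn tn lt).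
by move: (lt_trans lt e1); rewrite (ht_leaf lf tv) ltxx.
Qed.

Lemma cell_below (A : rtree) N (c : chart d A N) e v s t : has_height c e -> 0 <= e ->
  cell c v s t -> e < ht c v s -> e <= t.
Proof.
move=> he e0 [tv lo _] lt; have [vr|vr] := eqVneq v (rroot A).
  by move: lt; rewrite vr ht_root ltNge e0.
have cv := child_par vr; apply: le_trans (lo _ cv).
rewrite leNgt; apply/negP => h.
by have := has_height_between he cv tv h; rewrite leNgt lt.
Qed.

(** All arcs through [v] have the same core height there. If it exceeds [d i], the cell starts at or
    above the core of height [d i]; otherwise it is below [d j], and the cell stops at or before the
    core of height [d j]. *)
Lemma separated_small n (A : rtree) N (c : chart d A N) : (n <= N)%N ->
  (forall i, (i < N)%N -> has_height c (d i)) -> separated c -> small n c.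
Proof.
move=> nN hc sc v s s' t t' cv cv' i j iN jN dij.
have tv : thru c v s by case: cv.
have tv' : thru c v s' by case: cv'.
have {}iN := leq_trans iN nN; have {}jN := leq_trans jN nN.
have [_ e] := separated_ht tv (sc _ _ _ tv tv').
have /andP[i0 i1] := d01 i; have /andP[j0 j1] := d01 j.
split.
  apply/negP => /andP[ti jt].
  have [lt|le] := ltP (d i) (ht c v s).
    by have := cell_below (hc _ iN) i0 cv lt; rewrite leNgt ti.
  have lt : ht c v s' < d j by rewrite e; apply: le_lt_trans dij.
  by have := cell_above (hc _ jN) j1 cv' lt; rewrite leNgt jt.
move=> ne; apply: cell_above (hc _ jN) j1 cv _.
by apply: le_lt_trans dij; apply: sc tv tv' _ iN ne.
Qed.

(** An edge is bad if on some arc [d k] falls strictly between the cores of its ends. Splitting it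
    with preferred height [d k] makes neither half bad, and the other bad edges inject into the old
    ones, so their number drops. With none left, the last core not above [d k] on an arc is at
    [d k]. *)
Lemma add_height k (A : rtree) N (c : chart d A N) :
  exists (B : rtree) (g : B -> A) (c' : chart d B N),
  [/\ sc g, refines g c' c, has_height c' (d k)
    & forall e, has_height c e -> has_height c' e].
Proof.
pose bad (A : rtree) (c : chart d A N) := [set w : A | (w != rroot A) &&
  `[< exists2 s, thru c w s & ht c (par w) s < d k < ht c w s >]].
have [n] := ubnP #|bad A c|; elim: n A c => // n IH A c ltn.
have [bad0|[b]] := finset.set_0Vmem (bad A c).
  exists A, id, c; split=> //; first exact: sc_id.
  move=> s; have /andP[k0 k1] := d01 k; have [v [tv hv mx]] := last_below c s k0.
  exists v => //; apply/eqP; rewrite eq_le hv leNgt; apply/negP => lt.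
  have [[w cw]|lf] := nodeVleaf v.
    have [m cm tm] := thru_next cw tv; have /childP[mr pm] := cm.
    have : m \in bad A c.
      by rewrite inE mr; apply/asboolP; exists s; rewrite // pm lt mx.
    by rewrite bad0 inE.
  by move: (lt_trans lt k1); rewrite (ht_leaf lf tv) ltxx.
move=> bb; have br : b != rroot A by move: bb; rewrite inE => /andP[].
have [B [f [x [a [b' [sp fb _]]]]]] := split_exists br false.
have [c1 [r1 old new nbad]] := chart_split c k d01 d_dense sp.
have [ax xb] := (split_child_ax sp, split_child_xb sp).
have [xr nax nbx _] := split_neq sp.
have badP w : w \in bad B c1 -> [/\ w != x, w != b' & f w \in bad A c].
  rewrite inE => /andP[wr /asboolP[s tw hw]].
  have wx : w != x.
    apply/eqP => e; move: tw hw; rewrite e new => tb.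
    case/childP: ax => _ ->; have [_ ->] := old a s nax.
    by have [/negP h _] := nbad s tb.
  have wb : w != b'.
    apply/eqP => e; move: tw hw; rewrite e; case/childP: xb => _ ->.
    have [-> ->] := old b' s nbx; move=> tb.
    by have [_ /negP h] := nbad s tb.
  split=> //; have [px fp] := split_par sp wx wb wr.
  rewrite inE (split_nonroot sp wx wr) -fp; apply/asboolP; exists s.
    by have [<- _] := old w s wx.
  by have [_ <-] := old _ s px; have [_ <-] := old w s wx.
have {}ltn : (#|bad B c1| < n)%N.
  rewrite -ltnS; apply: leq_trans ltn; rewrite ltnS (cardsD1 b) bb add1n ltnS.
  rewrite -(@card_in_imset _ _ f); last first.
    by move=> u v /badP[ux _ _] /badP[vx _ _]; apply: split_inj sp _ _ ux vx.
  apply/subset_leq_card/fintype.subsetP => _ /finset.imsetP[w /badP[wx wb fw] ->].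
  rewrite in_setD1 fw andbT -fb; apply: contra wb => /eqP e.
  by apply/eqP; apply: split_inj sp _ _ wx nbx e.
have [C [g [c2 [sg r2 hk hc]]]] := IH B c1 ltn.
exists C, (f \o g), c2; split=> //.
- by apply: sc_comp sg _; apply: sc_split; apply: splitting_split_at sp.
- exact: refines_comp r2 r1.
move=> e he; apply: hc => s; have [v tv hv] := he s.
have [u ux fu] := split_onto sp v; exists u; have [h1 h2] := old u s ux.
  by rewrite h1 fu.
by rewrite h2 fu.
Qed.

Lemma add_heights n (A : rtree) N (c : chart d A N) :
  exists (B : rtree) (g : B -> A) (c' : chart d B N),
  [/\ sc g, refines g c' c & forall i, (i < n)%N -> has_height c' (d i)].
Proof.
elim: n => [|n [B [g [c1 [sg r1 h1]]]]].
  by exists A, id, c; split=> //; apply: sc_id.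
have [C [f [c2 [sf r2 h2 h2']]]] := add_height n c1.
exists C, (g \o f), c2; split; [exact: sc_comp|exact: refines_comp r2 r1|].
by move=> i; rewrite ltnS leq_eqVlt => /orP[/eqP->//|/h1/h2'].
Qed.

(** * Separating the arcs that have used different bits *)

Section Separate.
Variables (A : rtree) (N : nat) (c : chart d A N).
Hypothesis heights : forall i, (i < N)%N -> has_height c (d i).

Let word := {ffun 'I_N -> bool}.
Let ext (x : word) i := if insub i is Some j then x j else false.

Let ext_ord (x : word) (i : 'I_N) : ext x i = x i.
Proof. by rewrite /ext valK. Qed.

(* The bits of [s] that an arc passing through [v] has used up at height [ht c v s]. *)
Let nrm v s : word := [ffun i : 'I_N => (d i < ht c v s) && s i].

Let nagree t (s s' : nat -> bool) := forall i : 'I_N, s i != s' i -> t <= d i.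

Let nagree_ht v s s' : thru c v s -> nagree (ht c v s) s s' ->
  [/\ thru c v s', ht c v s' = ht c v s & nrm v s' = nrm v s].
Proof.
move=> tv ag; have [t e] : thru c v s' /\ ht c v s' = ht c v s.
  by apply: separated_ht => // i iN; apply: (ag (Ordinal iN)).
split=> //; apply/ffunP => i; rewrite !ffunE e; case: ltP => //= lt.
by apply/eqP; apply: contraTT lt => ne; rewrite -leNgt; apply: ag; rewrite eq_sym.
Qed.

Let nagree_nrm v s t : t <= ht c v s -> nagree t s (ext (nrm v s)).
Proof.
move=> le i; rewrite ext_ord ffunE; case: ltP => /= [_|h _]; first by rewrite eqxx.
exact: le_trans h.
Qed.

(** Replacing [s] by its word does not change the height at [v], so equal words give equal heights,
    and then the bits below that height coincide. *)
Let nrm_eq v s s' : thru c v s -> thru c v s' -> nrm v s = nrm v s' ->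
  nagree (ht c v s) s s' /\ ht c v s = ht c v s'.
Proof.
move=> tv tv' e.
have [_ h _] := nagree_ht tv (nagree_nrm (lexx _)).
have [_ h' _] := nagree_ht tv' (nagree_nrm (lexx _)).
have eh : ht c v s = ht c v s' by rewrite -h -h' e.
split=> // i ne; rewrite leNgt; apply/negP => lt.
move/ffunP/(_ i): e; rewrite !ffunE -eh lt /= => e.
by rewrite e eqxx in ne.
Qed.

(** A vertex with a word that occurs there, normalised by setting to [false] every bit whose value
    is not below the core. *)
Let okv (p : A * word) := thru c p.1 (ext p.2) && (nrm p.1 (ext p.2) == p.2).
Let V := {p : A * word | okv p}.

Let okv_nrm v s : thru c v s -> okv (v, nrm v s).
Proof.
move=> tv; rewrite /okv /=.
by have [-> _ ->] := nagree_ht tv (nagree_nrm (lexx _)); rewrite eqxx.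
Qed.

Let r : V := Sub (rroot A, nrm (rroot A) xpred0) (okv_nrm (thru_root c xpred0)).
Let mk v s : V := insubd r (v, nrm v s).
Let val_mk v s : thru c v s -> val (mk v s) = (v, nrm v s).
Proof. by move=> tv; rewrite val_insubd okv_nrm. Qed.

Let nrm_root s s' : nrm (rroot A) s = nrm (rroot A) s'.
Proof.
apply/ffunP => i; rewrite !ffunE !ht_root; have /andP[h _] := d01 i.
by rewrite ltNge h.
Qed.

Let g (p : V) : A := (val p).1.
Let wd (p : V) : word := (val p).2.
Let thru_p p : thru c (g p) (ext (wd p)).
Proof. by have := valP p; rewrite /okv => /andP[]. Qed.
Let nrm_p p : nrm (g p) (ext (wd p)) = wd p.
Proof. by have := valP p; rewrite /okv => /andP[_ /eqP]. Qed.

Let V_eq (p q : V) : g p = g q -> wd p = wd q -> p = q.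
Proof.
move=> e1 e2; apply: val_inj; move: e1 e2; rewrite /g /wd.
by case: (val p) (val q) => ? ? [? ?] /= -> ->.
Qed.

Let mk_g v s : thru c v s -> g (mk v s) = v.
Proof. by rewrite /g => /val_mk->. Qed.
Let mk_wd v s : thru c v s -> wd (mk v s) = nrm v s.
Proof. by rewrite /wd => /val_mk->. Qed.

Let g_root p : (g p == rroot A) = (p == r).
Proof.
apply/eqP/eqP => [gr|->//]; apply: V_eq => //.
by rewrite -nrm_p gr; apply: nrm_root.
Qed.

Let parV p : V := mk (par (g p)) (ext (wd p)).
Let parV_rk p : p != r -> (depth (g (parV p)) < depth (g p))%N.
Proof.
rewrite -g_root => gr; rewrite mk_g ?(depth_par gr) //.
by apply: thru_child (child_par gr) _; apply: thru_p.
Qed.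

Let cardV : (1 < #|{: V}|)%N.
Proof.
have [w wr] := exists_nonroot A; have [s tw] := thru_inhabited c w.
apply/card_gt1P; exists r, (mk w s); split=> //.
by rewrite eq_sym -g_root mk_g.
Qed.

Let B : rtree := parent_tree parV_rk cardV.

Let childB (p q : B) : child p q <-> [/\ child (g p) (g q) & wd p = nrm (g p) (ext (wd q))].
Proof.
have tq : g q != rroot A -> thru c (par (g q)) (ext (wd q)).
  by move=> gr; apply: thru_child (child_par gr) _; apply: thru_p.
split=> [/childP[qr]|[cpq e]].
  rewrite parent_treeE // => <-; have gr : g q != rroot A by rewrite g_root.
  by rewrite mk_g ?tq // mk_wd ?tq //; split=> //; apply: child_par.
have /childP[gr pq] := cpq; have qr : q != rroot B by rewrite -(g_root q).
apply/childP; split=> //; rewrite parent_treeE //; apply: V_eq.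
  by rewrite mk_g ?tq.
by rewrite mk_wd ?tq // pq e.
Qed.

Let nrm_child v w s : child v w -> thru c w s -> nrm v (ext (nrm w s)) = nrm v s.
Proof.
move=> cw tw; have tv := thru_child cw tw.
have ag := nagree_nrm (ltW (ht_child cw tw)).
by have [_ _ ->] := nagree_ht tv ag.
Qed.

Let cover_g : covering (g : B -> A).
Proof.
split=> // [q qr|p n cn].
  have gr : g q != rroot A by rewrite g_root.
  by have /childB[/childP[_ e] _] := child_par qr; rewrite e.
have [s' ag tn] := thru_split cn (thru_p p).
have ag' : nagree (ht c (g p) (ext (wd p))) (ext (wd p)) s' by move=> i; apply: ag.
have [_ _ e] := nagree_ht (thru_p p) ag'.
exists (mk n s'); last by rewrite mk_g.
by apply/childB; rewrite mk_g ?mk_wd // nrm_child // e nrm_p.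
Qed.

(* The refinement is the covering whose vertices remember the bits used so far. *)
Lemma separate : exists (B' : rtree) (f : B' -> A) (c' : chart d B' N),
  [/\ sc f, refines f c' c, forall i, (i < N)%N -> has_height c' (d i) & separated c'].
Proof.
pose T (p : B) s := thru c (g p) s && (nrm (g p) s == wd p).
have Tloc s s' : (forall i, (i < N)%N -> s i = s' i) -> forall p, T p s = T p s'.
  move=> e p; have [e1 e2] := chart_loc c e (g p).
  rewrite /T e1; congr (_ && (_ == _)); apply/ffunP => i.
  by rewrite !ffunE e2 (e i (ltn_ord i)).
have Troot s : T (rroot B) s.
  by rewrite /T thru_root; apply/eqP; apply: nrm_root.
have Tchild (p q : B) s : child p q -> T q s -> T p s.
  move=> /childB[cpq e] /andP[tq /eqP wq]; rewrite /T (thru_child cpq tq) e -wq.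
  by rewrite (nrm_child cpq tq) eqxx.
have Tthru p s : T p s -> thru c (g p) s by case/andP.
have Tmk n s : thru c n s -> T (mk n s) s by move=> tn; rewrite /T mk_g // mk_wd // tn eqxx.
have Tlift p n s : T p s -> child (g p) n -> thru c n s ->
    exists q, [/\ child p q, g q = n & T q s].
  move=> /andP[tp /eqP wp] cn tn; exists (mk n s); rewrite mk_g // Tmk //; split=> //.
  by apply/childB; rewrite mk_g // mk_wd // nrm_child.
have Tuniq (p q q' : B) s : child p q -> child p q' -> g q = g q' -> T q s -> T q' s -> q = q'.
  by move=> _ _ e /andP[_ /eqP h] /andP[_ /eqP h']; apply: V_eq; rewrite // -h -h' e.
have Tsagree (p q : B) s s' : child p q -> T q s -> sagree d (ht c (g p) s) s s' -> T q s'.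
  move=> /childB[cpq _] /andP[tq /eqP wq] ag.
  (* Here [heights] enters: on the arc no core lies strictly between those of [g p] and [g q], so a
     bit whose value exceeds the first core has a value at least the second. *)
  have ag' : nagree (ht c (g q) s) s s'.
    move=> i ne; apply: (has_height_between (heights (ltn_ord i)) cpq tq).
    exact: ag.
  by have [t' _ e] := nagree_ht tq ag'; rewrite /T t' e wq eqxx.
have Tsplit (p q : B) s : child p q -> T p s -> exists2 s', agree d (ht c (g p) s) s s' & T q s'.
  move=> /childB[cpq e] /andP[tp /eqP wp].
  (* The word of [q] decides the first [N] bits. It restricts to the word of [p], so [s] and [s']
     agree up to the core of [g p]. *)
  pose s' i := if (i < N)%N then ext (wd q) i else s i.
  have es' i : (i < N)%N -> s' i = ext (wd q) i by rewrite /s' => ->.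
  have tpq : thru c (g p) (ext (wd q)) by apply: thru_child cpq (thru_p q).
  have [ag _] := nrm_eq tp tpq (etrans wp e).
  exists s'; last by rewrite (Tloc _ _ es') /T thru_p nrm_p eqxx.
  move=> i; rewrite /s'; case: ifP => [iN|_]; last by rewrite eqxx.
  exact: (ag (Ordinal iN)).
have [c' [rf ec eh]] := chart_lift cover_g (leqnn N) Tloc Troot Tchild Tthru Tlift Tuniq
  Tsagree Tsplit.
exists B, g, c'; split=> //; first exact: covering_sc.
- move=> i iN s; have [v tv <-] := heights iN s.
  by exists (mk v s); rewrite ?ec ?eh ?mk_g //; apply: Tmk.
- move=> p s s'; rewrite !ec eh => /andP[tp /eqP wp] /andP[tp' /eqP wp'] i iN.
  have [ag _] := nrm_eq tp tp' (etrans wp (esym wp')).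
  exact: (ag (Ordinal iN)).
Qed.

End Separate.

Lemma chart_widen (A : rtree) N N' (c : chart d A N) : (N <= N')%N ->
  exists c' : chart d A N', refines id c' c.
Proof.
move=> NN'; pose loc s s' (e : forall i, (i < N')%N -> s i = s' i) :=
  chart_loc c (fun i iN => e i (leq_trans iN NN')).
by exists (Chart loc (thru_root c) (ht_root c) (@thru_child _ _ _ _ c) (@ht_child _ _ _ _ c)
  (@thru_next _ _ _ _ c) (@thru_uniq _ _ _ _ c) (@ht_leaf _ _ _ _ c) (@ht_node _ _ _ _ c)
  (@thru_sagree _ _ _ _ c) (@ht_agree _ _ _ _ c) (@thru_split _ _ _ _ c)).
Qed.

(** Widening puts the first [n] values among those of the bits the chart may read. Splitting and
    separating keep the number of bits, so all their heights can be inserted before the arcs are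
    separated. *)
Lemma chart_small n (A : rtree) N (c : chart d A N) :
  exists (B : rtree) (g : B -> A) M (c' : chart d B M),
  [/\ sc g, refines g c' c & small n c'].
Proof.
have [c0 r0] := chart_widen c (leq_maxl N n).
have [B [f [c1 [sf r1 h1]]]] := add_heights (maxn N n) c0.
have [C [g [c2 [sg r2 h2 s2]]]] := separate h1.
exists C, (f \o g), (maxn N n), c2; split; first exact: sc_comp.
  exact: refines_comp r2 (refines_comp r1 r0).
exact: separated_small (leq_maxr _ _) h2 s2.
Qed.

End Mesh.

(** * The Mohler-Nikiel dendroid *)

Local Open Scope classical_set_scope.
Local Open Scope ring_scope.

(** * Quotients, subspaces and products *)

Section QuotientBy.
Local Open Scope quotient_scope.
Variables (X : topologicalType) (r : X -> X -> Prop).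

Definition gpi (x : X) : gquot r := \pi_({eq_quot (geq_equiv r)}) x.
Definition grepr (q : gquot r) : X := repr (q : {eq_quot (geq_equiv r)}).

Lemma grepr_pi q : gpi (grepr q) = q.
Proof. exact: reprK. Qed.

Lemma gpi_eq x y : gpi x = gpi y <-> Relation_Operators.clos_refl_sym_trans X r x y.
Proof.
split=> [/eqmodP/asboolP//|h].
by apply/eqmodP/asboolP.
Qed.

Lemma gpi_repr x : Relation_Operators.clos_refl_sym_trans X r (grepr (gpi x)) x.
Proof. by apply/gpi_eq; rewrite grepr_pi. Qed.

Lemma gpi_continuous : continuous gpi.
Proof. exact: pi_continuous. Qed.

Lemma gquot_openE (U : set (gquot r)) : open U <-> open (gpi @^-1` U).
Proof. by []. Qed.

End QuotientBy.

Lemma hausdorff_separation (T : topologicalType) : (forall p q : T, p <> q ->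
  exists U V : set T, [/\ open U, open V, U p, V q & U `&` V = set0]) -> hausdorff_space T.
Proof.
move=> h p q cl; apply: contrapT => /h[U [V [oU oV Up Vq UV]]].
have [z] := cl U V (open_nbhs_nbhs (conj oU Up)) (open_nbhs_nbhs (conj oV Vq)).
by rewrite UV.
Qed.

Lemma hausdorff_separated (T : topologicalType) (p q : T) : hausdorff_space T -> p <> q ->
  exists U V : set T, [/\ open U, open V, U p, V q & U `&` V = set0].
Proof.
rewrite open_hausdorff => h /eqP/h[[U V] /= [pU qV] [oU oV UV]].
by exists U, V; split=> //; [exact/set_mem|exact/set_mem|exact/eqP].
Qed.

Lemma hausdorff_set_type (X : topologicalType) (A : set X) :
  hausdorff_space X -> hausdorff_space A.
Proof.
move=> h; apply: hausdorff_separation => p q npq.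
have /(hausdorff_separated h)[U [V [oU oV Up Vq UV]]] : set_val p <> set_val q.
  by move=> /val_inj.
exists (set_val @^-1` U), (set_val @^-1` V); split=> //.
- by exists U.
- by exists V.
- by rewrite -preimage_setI UV preimage_set0.
Qed.

Lemma compact_set_type (X : topologicalType) (A : set X) : compact A -> compact [set: A].
Proof.
move=> cA F FF _; pose G := fmap set_val F.
have GA : G A by apply: (@filterS _ F _ setT) => [x _|]; [exact: set_valP|exact: filterT].
have [x [Ax clx]] := cA G _ GA.
exists (exist _ x (mem_set Ax)); split=> // P Q FP [_ [[W oW <-] Wx sWQ]].
have [||z [[y Py yz] Wz]] := clx (set_val @` P) W.
- by apply: (@filterS _ F _ P) => // y Py; exists y.
- exact: (open_nbhs_nbhs (conj oW Wx)).
- by exists y; split=> //; apply: sWQ => /=; rewrite yz.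
Qed.

Lemma continuous_pair (X Y Z : topologicalType) (f : X -> Y) (g : X -> Z) :
  continuous f -> continuous g -> continuous (fun x => (f x, g x)).
Proof. by move=> cf cg x; apply: cvg_pair; [exact: cf|exact: cg]. Qed.

Lemma continuous_prod (X : topologicalType) (J : Type) (K : J -> topologicalType)
    (f : X -> prod_topology K) : (forall j, continuous (fun x => f x j)) -> continuous f.
Proof.
move=> h x; apply/cvg_sup => j.
exact: (@continuous_comp_initial _ _ _ (@proj J K j) f (h j)).
Qed.

(** * Coding the dendroid by the Cantor set times the interval *)

Section MNDendroid.
Variables (R : realType) (d : nat -> R).
Local Notation Y n := (projT1 (MNY d n)).
Local Notation I := (set_type (`[0%R, 1%R] : set R)).
Local Notation C := (prod_topology (fun _ : nat => bool)).

Definition MNh n : Y n -> R := projT2 (MNY d n).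

Definition MNglue n (p q : Y n * bool) : Prop := p.1 = q.1 /\ (MNh p.1 <= d n)%R.

Definition MNpi n (p : Y n * bool) : Y n.+1 := gpi (@MNglue n) p.
Definition MNrepr n (q : Y n.+1) : Y n * bool := @grepr _ (@MNglue n) q.

Lemma MNrepr_pi n (q : Y n.+1) : MNpi (MNrepr q) = q.
Proof. exact: grepr_pi. Qed.

(** Glued pairs share their first coordinate, whose height alone decides, so a chain of gluings
    collapses to a single one. *)
Lemma MNpi_eq n (p q : Y n * bool) :
  MNpi p = MNpi q <-> p.1 = q.1 /\ (p.2 = q.2 \/ (MNh p.1 <= d n)%R).
Proof.
rewrite /MNpi gpi_eq; split=> [|].
  elim=> {p q} [p q [-> ?]|p|p q _ [-> h]|p q u _ [e h] _ [<- h']]; split=> //.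
  - by right.
  - by left.
  - by case: h => h; [left|right].
  - by case: h => [->|h]; [rewrite e|right].
case: p q => [y j] [y' j'] /= [<- [<-|h]]; first exact: Relation_Operators.rst_refl.
exact: Relation_Operators.rst_step.
Qed.

Lemma MNg_pi n (p : Y n * bool) : MNg (MNpi p) = p.1.
Proof. by have /MNpi_eq[] := MNrepr_pi (MNpi p). Qed.

Lemma MNhS n (q : Y n.+1) : MNh q = MNh (MNg q).
Proof. by []. Qed.

Lemma MNpi_continuous n : continuous (@MNpi n).
Proof. exact: gpi_continuous. Qed.

Lemma MN_continuous n (Z : topologicalType) (f : Y n.+1 -> Z) :
  continuous (f \o @MNpi n) -> continuous f.
Proof. by move=> h; apply/quotient_continuous. Qed.

Lemma MNg_continuous n : continuous (@MNg R d n).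
Proof.
apply: MN_continuous.
have -> : @MNg R d n \o @MNpi n = fst by apply/funext => p; exact: MNg_pi.
by move=> p; exact: cvg_fst.
Qed.

Lemma MNh_continuous n : continuous (@MNh n).
Proof.
elim: n => [|n IH]; first exact: initial_continuous.
by move=> q; apply: (@continuous_comp _ _ _ (@MNg R d n) (@MNh n)); [exact: MNg_continuous|exact: IH].
Qed.

(** Points with different images in [Y n] are separated there. Two points over the same one lie
    above [d n] in different copies, and the part of each copy above [d n] is open because its
    preimage is. *)
Lemma MNY_hausdorff n : hausdorff_space (Y n).
Proof.
elim: n => [|n IH]; first exact/hausdorff_set_type/Rhausdorff.
apply: hausdorff_separation => p q npq.
have [e|ne] := EM (MNg p = MNg q); last first.
  have [U [V [oU oV Up Vq UV]]] := hausdorff_separated IH ne.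
  have cg := @MNg_continuous n; move/continuousP: cg => cg.
  exists (@MNg R d n @^-1` U), (@MNg R d n @^-1` V); split; [exact: cg|exact: cg|by []|by []|].
  by rewrite -preimage_setI UV preimage_set0.
pose W j : set (Y n.+1) := [set q | (d n < MNh q)%R /\ (MNrepr q).2 = j].
have oW j : open (W j).
  apply/gquot_openE; suff -> : gpi (@MNglue n) @^-1` W j =
      (@MNh n \o fst) @^-1` [set t | (d n < t)%R] `&` snd @^-1` [set j].
    apply: openI.
      suff /continuousP : continuous (@MNh n \o @fst (Y n) bool) by apply; exact: open_gt.
      by move=> y; apply: continuous_comp; [exact: cvg_fst|exact: MNh_continuous].
    have /continuousP : continuous (@snd (Y n) bool) by move=> y; exact: cvg_snd.
    by apply; exact: discrete_open.
  apply/seteqP; split=> [[y i]|[y i]] /=; rewrite /W /= MNhS MNg_pi /= => -[h1 h2]; split=> //.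
    have /MNpi_eq[/= e1 [//|]] := MNrepr_pi (MNpi (y, i)).
      by rewrite -/(MNpi _) in h2; rewrite h2 => ->.
    by rewrite e1 leNgt h1.
  have /MNpi_eq[/= e1 [->//|]] := MNrepr_pi (MNpi (y, i)).
  by rewrite e1 leNgt h1.
have rp := MNrepr_pi p; have rq := MNrepr_pi q.
have e1 : (MNrepr p).1 = (MNrepr q).1 by exact: e.
have lt : (d n < MNh p)%R.
  rewrite ltNge; apply/negP => le; apply: npq; rewrite -rp -rq.
  by apply/MNpi_eq; split=> //; right.
exists (W (MNrepr p).2), (W (MNrepr q).2); split=> //.
- by split=> //; rewrite MNhS -e.
- apply/seteqP; split=> // u [[_ h1] [_ h2]]; apply: npq; rewrite -rp -rq.
  by apply/MNpi_eq; split=> //; left; rewrite -h1 h2.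
Qed.

Lemma MN_hausdorff : hausdorff_space (MN_dendroid d).
Proof.
apply: hausdorff_set_type.
by apply: (@hausdorff_product nat (fun n => Y n)) => n; apply: MNY_hausdorff.
Qed.

Fixpoint code n (p : C * I) : Y n :=
  match n with
  | 0 => p.2
  | m.+1 => MNpi (code m p, p.1 m)
  end.

Lemma MNh_code n p : MNh (code n p) = set_val p.2.
Proof. by elim: n => //= n IH; rewrite MNhS MNg_pi. Qed.

Lemma code_eq n p q : code n p = code n q <->
  p.2 = q.2 /\ forall i, (i < n)%N -> p.1 i != q.1 i -> set_val p.2 <= d i.
Proof.
elim: n => [|n IH] /=; first by split=> [->//|[]].
rewrite MNpi_eq /= IH MNh_code; split=> [[[-> h] h']|[-> h]].
  split=> // i; rewrite ltnS leq_eqVlt => /orP[/eqP->|/h//].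
  by case: h' => [->|//]; rewrite eqxx.
split; first by split=> // i iN; apply: h; apply: leqW.
have [->|ne] := eqVneq (p.1 n) (q.1 n); first by left.
by right; apply: h ne.
Qed.

Lemma code_continuous n : continuous (code n).
Proof.
elim: n => [|n IH]; first by move=> p; exact: cvg_snd.
have cn : continuous (fun p : C * I => p.1 n).
  move=> p; apply: (@continuous_comp _ _ _ fst (fun s : C => s n)); first exact: cvg_fst.
  exact: (@proj_continuous nat (fun=> bool)).
by move=> p; apply: (@continuous_comp _ _ _ (fun p => (code n p, p.1 n)) (@MNpi n));
  [exact: continuous_pair|exact: MNpi_continuous].
Qed.

Lemma code_thread p n : MNg (code n.+1 p) = code n p.
Proof. exact: MNg_pi. Qed.

Definition MNcode (p : C * I) : MN_dendroid d :=
  exist _ (fun n => code n p) (mem_set (code_thread p)).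

Lemma MNcode_eq p q :
  MNcode p = MNcode q <-> p.2 = q.2 /\ agree d (set_val p.2) p.1 q.1.
Proof.
split=> [/(congr1 set_val) e|[e ag]].
  have h n : code n p = code n q := congr1 (fun f => f n) e.
  have /code_eq[-> _] := h 0%N; split=> // i.
  by have /code_eq[-> hi] := h i.+1; apply: hi.
apply: val_inj; apply: functional_extensionality_dep => n /=.
by apply/code_eq; split=> // i _; apply: ag.
Qed.

Lemma MNcode_surj z : exists p, MNcode p = z.
Proof.
pose y n : Y n := set_val z n.
have yt n : MNg (y n.+1) = y n by apply: (set_valP z).
(* Where the two copies are glued, the bit of the representative is arbitrary and either value codes
   the same point. *)
pose p : C * I := ((fun n => (MNrepr (y n.+1)).2), y 0%N).
exists p; apply: val_inj; apply: functional_extensionality_dep => n /=.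
elim: n => [//|n IH]; rewrite /= IH -[RHS](MNrepr_pi (y n.+1)); congr MNpi.
have e : (MNrepr (y n.+1)).1 = y n := yt n.
by rewrite [RHS]surjective_pairing e.
Qed.

Lemma MNcode_continuous : continuous MNcode.
Proof.
apply: continuous_comp_initial; apply: continuous_prod => n.
exact: code_continuous.
Qed.

Lemma code_space_compact : compact [set: C * I].
Proof.
rewrite -setXTT; apply: compact_setX.
  have := @tychonoff _ (fun _ : nat => _) _ (fun=> bool_compact).
  by congr (compact _); apply/seteqP.
exact/compact_set_type/segment_compact.
Qed.

End MNDendroid.

(** * Threads and cells *)

(** The fibres of [f] are the classes of [r], so [f] induces a continuous bijection. Its inverse is
    continuous because closed sets of the compact [X] have compact, hence closed, images in [Y]. *)
Lemma quotient_homeomorphic (X Y : topologicalType) (r : X -> X -> Prop) (f : X -> Y) :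
  compact [set: X] -> hausdorff_space Y -> continuous f -> (forall y, exists x, f x = y) ->
  (forall x x', f x = f x' <-> r x x') -> homeomorphic (gquot r) Y.
Proof.
move=> cX hY cf /choice[sec secK] fr.
have geqf x x' : Relation_Operators.clos_refl_sym_trans X r x x' -> f x = f x'.
  by elim=> {x x'} [x x' /fr//|//|x x' _ ->//|x x' x'' _ -> _ ->].
pose h (q : gquot r) := f (grepr q).
have hpi x : h (gpi r x) = f x by apply: geqf; apply: gpi_repr.
exists h, (fun y => gpi r (sec y)); split.
- move=> q; rewrite -[RHS]grepr_pi; apply/gpi_eq/Relation_Operators.rst_step.
  by apply/fr; rewrite secK.
- by move=> y; rewrite hpi secK.
- by apply/quotient_continuous; rewrite (_ : _ \o _ = f) //; apply/funext => x; exact: hpi.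
apply/continuous_closedP => Z cZ.
have -> : (fun y => gpi r (sec y)) @^-1` Z = f @` (gpi r @^-1` Z).
  apply/seteqP; split=> [y Zy|_ [x Zx <-]] /=; first by exists (sec y).
  suff -> : gpi r (sec (f x)) = gpi r x by [].
  by apply/gpi_eq/Relation_Operators.rst_step/fr; rewrite secK.
apply: compact_closed => //; apply: continuous_compact.
  exact: continuous_subspaceT.
apply: subclosed_compact cX _ => //.
by apply: preimage_closed cZ => x _; apply: gpi_continuous.
Qed.

Lemma compact_decreasing (T : topologicalType) (K : nat -> set T) : compact [set: T] ->
  (forall k, closed (K k)) -> (forall k, K k.+1 `<=` K k) -> (forall k, K k !=set0) ->
  exists p, forall k, K k p.
Proof.
move=> cT cK decr ne.
have mono k l : (k <= l)%N -> K l `<=` K k.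
  move=> /subnK<-; elim: (l - k)%N => [//|n IH]; rewrite addSn.
  exact: subset_trans (decr _) IH.
pose G := filter_from [set: nat] K.
have GF : ProperFilter G.
  apply: filter_from_proper => [|k _]; last exact: ne.
  apply: filter_from_filter; first by exists 0%N.
  move=> k l _ _; exists (maxn k l) => //.
  by move=> z hz; split; [exact: mono (leq_maxl k l) _ hz|exact: mono (leq_maxr k l) _ hz].
have [p [_ clp]] := cT G GF (filterT : G setT).
exists p => k; apply: cK => B nB; apply: clp => //.
by exists k.
Qed.

Section Cells.
Variables (R : realType) (d : nat -> R).
Local Notation I := (set_type (`[0%R, 1%R] : set R)).
Local Notation C := (prod_topology (fun _ : nat => bool)).

Definition cells (A : rtree) N (c : chart d A N) (v : A) : set (C * I) :=
  [set p | cell c v p.1 (set_val p.2)].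

Lemma nbhs_prefix N (p : C * I) :
  nbhs p [set q : C * I | forall i, (i < N)%N -> q.1 i = p.1 i].
Proof.
elim: N => [|N IH].
  by apply: (@filterS _ (nbhs p) _ setT) => [q _ i|]; [|exact: filterT].
have bN : nbhs p [set q : C * I | q.1 N = p.1 N].
  have cN : continuous (fun q : C * I => q.1 N).
    move=> q; apply: (@continuous_comp _ _ _ fst (fun s : C => s N)); first exact: cvg_fst.
    exact: (@proj_continuous nat (fun=> bool)).
  apply: (cN p [set p.1 N]); apply: open_nbhs_nbhs; split=> //.
  exact: discrete_open.
apply: filterS (filterI IH bN) => q [h hN] i; rewrite ltnS leq_eqVlt.
by move=> /orP[/eqP->|/h].
Qed.

(** Near [p] the first [N] bits are constant, and for fixed bits a cell is cut out by weak
    inequalities on the height. *)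
Lemma cells_closed (A : rtree) N (c : chart d A N) v : closed (cells c v).
Proof.
move=> p clp; pose S : set R := [set t | cell c v p.1 t].
have cS : closed S.
  have [tv|ntv] := boolP (thru c v p.1); last first.
    have -> : S = set0 by apply/seteqP; split=> // t [tv]; rewrite tv in ntv.
    exact: closed0.
  have -> : S = (\bigcap_(u in [set u | child u v]) [set t | ht c u p.1 <= t]) `&`
      (\bigcap_(w in [set w | child v w /\ thru c w p.1]) [set t | t <= ht c w p.1]).
    apply/seteqP; split=> [t [_ lo hi]|t [lo hi]].
      by split=> [u /lo//|w [cw /(hi _ cw)]].
    by split=> // w cw tw; apply: hi.
  by apply: closedI; apply: closed_bigI => u _; [exact: closed_ge|exact: closed_le].
suff : closed [set q : C * I | S (set_val q.2)].
  apply => B nB.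
  have [q [cq [Bq pq]]] := clp _ (filterI nB (nbhs_prefix N p)).
  exists q; split=> //; move: cq => -[tv lo hi].
  have e u := chart_loc c pq u.
  split=> [|u cu|w cw]; first by have [<- _] := e v.
    by have [_ <-] := e u; apply: lo.
  by have [<- <-] := e w; apply: hi.
apply: (@preimage_closed _ _ (fun q : C * I => set_val q.2)) cS => q _.
apply: (@continuous_comp _ _ _ snd (@set_val _ _)); first exact: cvg_snd.
exact: initial_continuous.
Qed.

End Cells.

Section Threads.
Variables (F : nat -> rtree) (alpha : forall n, F n.+1 -> F n).
Hypothesis sc_alpha : forall n, sc (@alpha n).
Local Notation T := (Defs.limV alpha).

Definition pr n (x : T) : F n := set_val x n.

Lemma pr_alpha n (x : T) : alpha (pr n.+1 x) = pr n x.
Proof. exact: (set_valP x n). Qed.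

Lemma pr_edge_le m n (x y : T) : (m <= n)%N ->
  rE (F n) (pr n x) (pr n y) -> rE (F m) (pr m x) (pr m y).
Proof.
move=> /subnK<-; elim: (n - m)%N => [//|k IH]; rewrite addSn => /(sc_edge (@sc_alpha _)).
by rewrite !pr_alpha.
Qed.

Lemma pr_comp m k : exists2 a : F (k + m)%N -> F m, sc a & forall x : T, a (pr _ x) = pr m x.
Proof.
elim: k => [|k [a sa ea]]; first by exists id => //; exact (sc_id (F m)).
exists (a \o @alpha _); first exact: (sc_comp (sc_alpha _) sa).
by move=> x; rewrite /= pr_alpha.
Qed.

Lemma limV_compact : compact [set: T].
Proof.
apply: compact_set_type.
have cP : compact [set: prod_topology (fun n => discrete_topology (F n))].
  have := @tychonoff _ (fun n => discrete_topology (F n)) (fun=> setT).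
  have -> : [set f : forall n, discrete_topology (F n) | forall n, setT (f n)] = setT.
    by apply/seteqP.
  by apply=> n; apply: finite_compact; exact: (@finite_finset (F n)).
apply: (subclosed_compact _ cP) => // x clx n.
have nb i : nbhs x [set y : prod_topology (fun n => discrete_topology (F n)) | y i = x i].
  apply: (@proj_continuous nat (fun n => discrete_topology (F n)) i x [set x i]).
  by apply: open_nbhs_nbhs; split=> //; exact: discrete_open.
by have [y [ty [/= <- <-]]] := clx _ (filterI (nb n.+1) (nb n)).
Qed.

Lemma nbhs_pr n (x : T) : nbhs x [set y : T | pr n y = pr n x].
Proof.
have c1 : continuous (fun y : T => proj n (set_val y : prod_topology (fun n => discrete_topology (F n)))).
  move=> y; apply: (@continuous_comp _ _ _ (@set_val _ _)); first exact: initial_continuous.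
  exact: proj_continuous.
apply: (c1 x [set pr n x]); apply: open_nbhs_nbhs; split=> //.
exact: discrete_open.
Qed.

End Threads.

(** Surjectivity extends [u] upwards and the downward part is forced. The induction on [m] shifts
    the whole sequence, which avoids transport between levels. *)
Lemma thread_through (F : nat -> rtree) (alpha : forall n, F n.+1 -> F n) :
  (forall n, sc (alpha n)) -> forall m (u : F m), exists x : Defs.limV alpha, pr m x = u.
Proof.
move=> sca m; suff aux : forall u : F m, exists y : forall n, F n,
    (forall n, alpha n (y n.+1) = y n) /\ y m = u.
  by move=> u; have [y [ty <-]] := aux u; exists (exist _ y (mem_set ty)).
elim: m F alpha sca => [|m IH] F alpha sca u; last first.
  have [y [ty <-]] := IH (fun n => F n.+1) (fun n => alpha n.+1) (fun n => sca n.+1) u.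
  exists (fun n => if n is k.+1 then y k else alpha 0%N (y 0%N)); split=> //.
  by case.
pose s n (v : F n) : F n.+1 := projT1 (cid (sc_onto (sca n) v)).
have sK n v : alpha n (s n v) = v by rewrite /s; case: cid.
pose y := fix y n : F n := if n is k.+1 then s k (y k) else u.
by exists y; split=> // n; apply: sK.
Qed.

(** * The homeomorphism *)

(** The root has a child, so its core height 0 must be a value of [d]. No bit is read: every arc
    runs from the root to the leaf. *)
Lemma edge_chart (R : realType) (d : nat -> R) : (exists n, d n = 0) ->
  inhabited (chart d edge_tree 0).
Proof.
move=> [n0 dn0].
pose T (v : edge_tree) (s : nat -> bool) := true.
pose H (v : edge_tree) (s : nat -> bool) : R := if (v : bool) then 1 else 0.
have H0 v s (w : edge_tree) : child v w -> H v s = 0 by rewrite edge_tree_child /H; case: v.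
have H1 v s (w : edge_tree) : child v w -> H w s = 1.
  by rewrite edge_tree_child /H; case: w => //; rewrite andbF.
have loc s s' : (forall i, (i < 0)%N -> s i = s' i) -> forall v, T v s = T v s' /\ H v s = H v s'.
  by [].
have Hroot s : H (rroot edge_tree) s = 0 by [].
have Hchild v w s : child v w -> T w s -> H v s < H w s.
  by move=> cw _; rewrite (H0 _ _ _ cw) (H1 _ _ _ cw).
have Tnext v w s : child v w -> T v s -> exists2 w', child v w' & T w' s.
  by move=> cw _; exists w.
have Tuniq (v w w' : edge_tree) s : child v w -> child v w' -> T w s -> T w' s -> w = w'.
  by rewrite !edge_tree_child => /andP[_ hw] /andP[_ hw'] _ _; case: w w' hw hw' => -[].
have Hleaf (v : edge_tree) s : (forall w, ~~ child v w) -> T v s -> H v s = 1.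
  by move=> lf _; move: (lf true); rewrite edge_tree_child /H; case: v {lf}.
have Hnode (v w : edge_tree) s : child v w -> T v s -> exists i, H v s = d i.
  by move=> cw _; exists n0; rewrite (H0 _ _ _ cw).
have Tsplit (v w : edge_tree) s : child v w -> T v s ->
    exists2 s', agree d (H v s) s s' & T w s'.
  by exists s => //; apply: agree_refl.
by constructor; exact (@Chart R d edge_tree 0 T H loc (fun=> isT) Hroot (fun _ _ _ _ _ => isT) Hchild Tnext
  Tuniq Hleaf Hnode (fun _ _ _ _ _ _ _ => isT) (fun _ _ _ _ _ => erefl) Tsplit).
Qed.

Lemma tree_middle_unique (A : rtree) (p q y z : A) : ~~ rE A p q ->
  rE A p y -> rE A y q -> rE A p z -> rE A z q -> y = z.
Proof.
move=> npq py yq pz zq.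
have pq : p != q by apply: contraNneq npq => ->; apply: rE_refl.
have mid u : rE A p u -> rE A u q -> spath (rE A) p q [:: u; q].
  move=> pu uq; have pu' : p != u by apply: contraNneq npq => ->.
  have uq' : u != q by apply: contraNneq npq => <-.
  by rewrite /spath /= pu uq pu' uq' eqxx !inE !negb_or pu' pq uq'.
have [r [_ u]] := r_tree p q.
by have := u _ (mid y py yq); rewrite (u _ (mid z pz zq)) => -[].
Qed.

(* Splitting an edge at [y], with the new vertex sent to [y], separates the two neighbours. *)
Lemma split_middle (A : rtree) (p q y : A) : ~~ rE A p q -> rE A p y -> rE A y q ->
  exists (B : rtree) (f : B -> A), sc f /\
    forall v u w, rE B v u -> rE B u w -> f v = p -> f w = q -> False.
Proof.
move=> npq py yq.
have npy : p != y by apply: contraNneq npq => ->.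
have nyq : y != q by apply: contraNneq npq => <-.
have pq : p != q by apply: contraNneq npq => ->; apply: rE_refl.
(* [b] is the child end of the edge between [p] and [y]; [up] is set so that the new vertex goes to
   [y], whichever end that is. *)
have [b [up [br [hy hp]]]] : exists b up, b != rroot A /\
    (if up then b else par b) = y /\ (if up then par b else b) = p.
  case/edgeP: py => [e|/childP[yr e]|/childP[pr e]].
  - by rewrite e eqxx in npy.
  - by exists y, true.
  - by exists p, false.
have [B [f [x [a [b' [sp fb fx]]]]]] := split_exists br up.
rewrite hy in fx; exists B, f; split; first by apply/sc_split/(splitting_split_at sp).
move=> v u w vu uw fv fw.
have [xr ax bx ab] := split_neq sp.
have fa : f a = par b by have /childP[_ <-] := split_old_edge sp; rewrite fb.
have fab z : z = a \/ z = b' -> f z = y \/ f z = p.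
  by move: hy hp; case: (up) => <- <- [->|->]; rewrite ?fa ?fb; [right|left|left|right].
have [_ [Ex [nab [_ [_ [Ef _]]]]]] := sp.
have fu : f u = y.
  apply/esym; apply: (tree_middle_unique npq py yq).
    by rewrite -fv; apply: split_edge sp _ _ vu.
  by rewrite -fw; apply: split_edge sp _ _ uw.
have wx : w != x by apply: contraNneq nyq => e; rewrite -fw e fx.
have vx : v != x by apply: contraNneq npy => e; rewrite -fv e fx.
(* The neighbours of the new vertex lie over [y] and [p], none over [q]; the old vertex over [y] has
   lost its edge to the one over [p]. *)
have [ux|ux] := eqVneq u x.
  move: uw; rewrite ux Ex (negbTE wx) /= => /orP h.
  have [|e|e] := fab w; first by case: h => /eqP; [left|right].
  - by move: nyq; rewrite -fw e eqxx.
  - by move: pq; rewrite -fw e eqxx.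
have : (v == a) && (u == b') || (v == b') && (u == a).
  move: hy hp; case: (up) => hb hb'.
    have -> : v = a by apply: (split_inj sp) => //; rewrite fv fa.
    have -> : u = b' by apply: (split_inj sp) => //; rewrite fu fb.
    by rewrite !eqxx.
  have -> : v = b' by apply: (split_inj sp) => //; rewrite fv fb.
  have -> : u = a by apply: (split_inj sp) => //; rewrite fu fa.
  by rewrite !eqxx orbT.
case/orP => /andP[/eqP e1 /eqP e2]; move: vu; rewrite e1 e2.
  by rewrite (negbTE nab).
by rewrite rE_sym (negbTE nab).
Qed.

(** * Charts along a Fraisse limit and the induced map *)

Section Limit.
Variables (F : nat -> rtree) (alpha : forall n, F n.+1 -> F n).
Variables (R : realType) (d : nat -> R).
Hypothesis fl : fraisse_limit alpha.
Hypothesis mn : MN_sequence d.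
Local Notation T := (Defs.limV alpha).
Local Notation I := (set_type (`[0%R, 1%R] : set R)).
Local Notation C := (prod_topology (fun _ : nat => bool)).

Lemma MN_d01 n : 0 <= d n < 1.
Proof. by case: mn. Qed.

Lemma MN_dense (p q : R) : 0 <= p -> p < q -> q <= 1 -> exists n, p < d n < q.
Proof.
move=> p0 pq q1; case: mn => _ h _ _.
have x01 : 0 <= (p + q) / 2 < 1.
  rewrite divr_ge0 ?addr_ge0 ?(le_trans p0 (ltW pq)) //=.
  by rewrite ltr_pdivrMr // mul1r; apply: ltr_leD => //; apply: lt_le_trans q1.
have e0 : 0 < (q - p) / 2 by rewrite divr_gt0 // subr_gt0.
have [n] := h _ x01 _ e0; rewrite ltr_distl => /andP[h1 h2]; exists n.
by rewrite (le_lt_trans _ h1) ?(lt_le_trans h2) //; lra.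
Qed.

Lemma MN_repeats n K : exists m, (K < m)%N /\ d m = d n.
Proof. by case: mn => _ _ _ h; apply: h. Qed.

Let sc_alpha n : sc (@alpha n).
Proof. by case: fl => h _; apply: h. Qed.

Let admissible_pr m : admissible (@pr F alpha m).
Proof. by exists m, id; split=> //; apply: sc_id. Qed.

Record stage := Stage { level : nat; bits : nat; stage_chart : chart d (F level) bits }.

(** Refinement is stated along threads, because the extension property compares maps on the
    limit. *)
Definition step n (s s' : stage) : Prop :=
  [/\ (level s < level s')%N, small n (stage_chart s')
    & forall (x : T) w t, cell (stage_chart s') (pr (level s') x) w t ->
        cell (stage_chart s) (pr (level s) x) w t].

Lemma step_exists n s : exists s', step n s s'.
Proof.
case: s => m N c.
have [B [g [M [c1 [sg r1 sm]]]]] := chart_small MN_d01 MN_dense n c.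
have [_ [_ lift]] := fl.
have [h [[m0 [h' [sh eh]]] gh]] := lift _ _ _ _ (admissible_pr m) sg.
(* The shift by [m.+1] puts the new level strictly above [m], whatever level [h] factors through. *)
have [a sa ea] := pr_comp sc_alpha m0 m.+1.
have [L [c2 r2]] := chart_sc MN_d01 MN_dense MN_repeats (sc_comp sa sh) c1.
exists (Stage c2); split=> /=; first by rewrite addSn ltnS leq_addr.
  exact: small_refines r2 sm.
move=> x w t /r2/r1 /=; rewrite ea => hc.
have e : pr m x = g (h' (pr m0 x)) by rewrite gh /= eh.
by rewrite e.
Qed.

Lemma stage_exists : inhabited stage.
Proof.
have [_ [ex _]] := fl; have [h [m [h' [sh _]]]] := ex edge_tree.
have [_ _ d0 _] := mn; have [c] := edge_chart d0.
have [M [c' _]] := chart_sc MN_d01 MN_dense MN_repeats sh c.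
exact: inhabits (Stage c').
Qed.

Definition next n s := projT1 (cid (step_exists n s)).

Fixpoint stages n : stage :=
  if n is k.+1 then next k (stages k) else inhabited_witness stage_exists.

Lemma stagesP n : step n (stages n) (stages n.+1).
Proof. by rewrite /= /next; case: cid. Qed.

Local Notation lv k := (level (stages k)).
Local Notation ch k := (stage_chart (stages k)).

Lemma level_ge k : (k <= lv k)%N.
Proof. by elim: k => [//|k IH]; have [h _ _] := stagesP k; apply: leq_ltn_trans h. Qed.

Definition near_thread (x : T) k : set (C * I) := cells (ch k) (pr (lv k) x).

Lemma near_thread_closed x k : closed (near_thread x k).
Proof. exact: cells_closed. Qed.

Lemma near_thread_decr x k : near_thread x k.+1 `<=` near_thread x k.
Proof. by move=> p; have [_ _ h] := stagesP k; apply: h. Qed.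

Lemma near_thread_edge x y k : rE (F (lv k)) (pr (lv k) x) (pr (lv k) y) ->
  near_thread x k `&` near_thread y k !=set0.
Proof.
move=> /(cell_edge (ch k) MN_d01)[s [t [t01 cx cy]]].
have ti : t \in `[0%R, 1%R] by rewrite in_itv.
by exists (s : C, exist _ t (mem_set ti) : I).
Qed.

Definition near_all x (p : C * I) := forall k, near_thread x k p.

Lemma near_all_mesh x p q i j : near_all x p -> near_all x q -> d i < d j ->
  ~~ ((set_val p.2 < d i) && (d j < set_val q.2)) /\ (p.1 i != q.1 i -> set_val p.2 <= d j).
Proof.
move=> hp hq dij; pose n := (maxn i j).+1; have [_ h _] := stagesP n.
by apply: (h _ _ _ _ _ (hp n.+1) (hq n.+1)) dij; rewrite ltnS ?leq_maxl ?leq_maxr.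
Qed.

Lemma set_val01 (t : I) : 0 <= set_val t <= 1.
Proof. by have := set_valP t; rewrite /= in_itv. Qed.

(** If the heights differed, density would put two values [d i < d j] strictly between them, which
    the mesh condition excludes at a late stage. *)
Lemma near_all_le x p q : near_all x p -> near_all x q -> set_val q.2 <= set_val p.2.
Proof.
move=> hp hq; rewrite leNgt; apply/negP => lt.
have /andP[p0 _] := set_val01 p.2; have /andP[_ q1] := set_val01 q.2.
have [i /andP[h1 h2]] := MN_dense p0 lt q1.
have [j /andP[h3 h4]] := MN_dense (ltW (le_lt_trans p0 h1)) h2 q1.
by have [+ _] := near_all_mesh hp hq h3; rewrite h1 h4.
Qed.

Lemma near_all_unique x p q : near_all x p -> near_all x q -> MNcode d p = MNcode d q.
Proof.
move=> hp hq; apply/MNcode_eq; split.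
  by apply: val_inj; apply/eqP; rewrite eq_le !(near_all_le (x := x)).
move=> i ne; rewrite leNgt; apply/negP => lt.
have /andP[i0 _] := MN_d01 i; have /andP[_ p1] := set_val01 p.2.
have [j /andP[h1 h2]] := MN_dense i0 lt p1.
by have [_ /(_ ne)] := near_all_mesh hp hq h1; rewrite leNgt h2.
Qed.

Lemma near_all_exists x : exists p, near_all x p.
Proof.
apply: compact_decreasing; [exact: code_space_compact|exact: near_thread_closed| |].
  exact: near_thread_decr.
by move=> k; have [p [hp _]] := near_thread_edge (rE_refl (pr (lv k) x)); exists p.
Qed.

Definition place x : C * I := projT1 (cid (near_all_exists x)).

Lemma placeP x : near_all x (place x).
Proof. by rewrite /place; case: cid. Qed.

Definition limit_map x : MN_dendroid d := MNcode d (place x).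

Lemma limit_map_eq x p : near_all x p -> limit_map x = MNcode d p.
Proof. by apply: near_all_unique; apply: placeP. Qed.

(** The threads whose cell at stage [k] contains [p] form decreasing closed sets, nonempty because
    cells cover every arc and every vertex lies on a thread. *)
Lemma limit_map_surj z : exists x, limit_map x = z.
Proof.
have [p <-] := MNcode_surj z.
suff [x hx] : exists x, forall k, near_thread x k p by exists x; apply: limit_map_eq.
apply: (@compact_decreasing T (fun k => [set x | near_thread x k p])).
- exact: limV_compact.
- move=> k x clx; have [y [hy e]] := clx _ (nbhs_pr (lv k) x).
  by move: hy; rewrite /near_thread /= e.
- by move=> k x; apply: near_thread_decr.
move=> k; have /andP[p0 _] := set_val01 p.2.
have [v hv] := cell_cover (ch k) p.1 p0.
by have [x e] := thread_through sc_alpha v; exists x; rewrite /near_thread /= e.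
Qed.

Lemma limit_map_edge x y : limE x y -> limit_map x = limit_map y.
Proof.
move=> exy; have [p hp] : exists p, forall k, (near_thread x k `&` near_thread y k) p.
  apply: compact_decreasing; first exact: code_space_compact.
  - by move=> k; apply: closedI; apply: near_thread_closed.
  - by move=> k p [h1 h2]; split; apply: near_thread_decr.
  - by move=> k; apply: near_thread_edge; apply: exy.
by rewrite (@limit_map_eq x p) ?(@limit_map_eq y p) // => k; case: (hp k).
Qed.

(** A common point of two cells only brings their vertices within distance two, and the middle
    vertex may change with [k]; adjacency has to come from the extension property. *)
Lemma limit_map_near x y k : limit_map x = limit_map y ->
  exists2 z : T, rE (F (lv k)) (pr (lv k) x) (pr (lv k) z)
    & rE (F (lv k)) (pr (lv k) z) (pr (lv k) y).
Proof.
move=> /MNcode_eq[e ag]; have /andP[p0 _] := set_val01 (place x).2.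
have hy : cell (ch k) (pr (lv k) y) (place y).1 (set_val (place x).2).
  by rewrite e; apply: placeP.
have [u h1 h2] := cell_near p0 ag (placeP x k) hy.
by have [z ez] := thread_through sc_alpha u; exists z; rewrite ez.
Qed.

(* If [x] and [y] were not adjacent at level [m], splitting the edge between [x] and the middle
   vertex would produce a member of the family onto which no common neighbour could be lifted. *)
Lemma limit_map_kernel x y : limit_map x = limit_map y -> limE x y.
Proof.
move=> exy m; apply: contrapT => /negP nxy.
have [z /(pr_edge_le sc_alpha (level_ge m)) xz /(pr_edge_le sc_alpha (level_ge m)) zy] :=
  limit_map_near m exy.
have [B [f [sf hf]]] := split_middle nxy xz zy.
have [_ [_ lift]] := fl.
have [h [[n [h' [sh eh]]] fh]] := lift _ _ _ _ (admissible_pr m) sf.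
(* A common neighbour at the level through which [h] factors; [h'] carries it to a common neighbour
   in [B]. *)
have [u xu uy] := limit_map_near n exy.
have {}xu := sc_edge sh (pr_edge_le sc_alpha (level_ge n) xu).
have {}uy := sc_edge sh (pr_edge_le sc_alpha (level_ge n) uy).
by apply: (hf _ _ _ xu uy); rewrite -eh; apply/esym/fh.
Qed.

(** If the image of [x] is off [Z], compactness yields a stage at which the whole cell of [x] avoids
    the preimage of [Z]; then so does every thread that agrees with [x] at that level. *)
Lemma limit_map_continuous : continuous limit_map.
Proof.
apply/continuous_closedP => Z cZ x clx; apply: contrapT => nZ.
pose K k := near_thread x k `&` MNcode d @^-1` Z.
have cK k : closed (K k).
  apply: closedI; first exact: near_thread_closed.
  by apply: preimage_closed cZ => p _; apply: MNcode_continuous.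
have [ne|/existsNP[k hk]] := pselect (forall k, K k !=set0).
  have [p hp] : exists p, forall k, K k p.
    apply: compact_decreasing ne => //; first exact: code_space_compact.
    by move=> k p [h1 h2]; split=> //; apply: near_thread_decr.
  by apply: nZ; rewrite /= (@limit_map_eq x p) => [|k]; [case: (hp 0%N)|case: (hp k)].
have [y [Zy e]] := clx _ (nbhs_pr (lv k) x).
by apply: hk; exists (place y); split=> //; rewrite /near_thread -e; apply: placeP.
Qed.

End Limit.

Theorem theorem10p1 (F : nat -> rtree) (alpha : forall n : nat, F n.+1 -> F n)
  (R : realType) (d : nat -> R) :
  fraisse_limit alpha -> MN_sequence d ->
  homeomorphic (realization alpha) (MN_dendroid d).
Proof.
move=> fl mn; apply: (quotient_homeomorphic (f := @limit_map F alpha R d fl mn)).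
- exact: limV_compact.
- exact: MN_hausdorff.
- exact: limit_map_continuous.
- exact: limit_map_surj.
- by move=> x y; split; [apply: limit_map_kernel|apply: limit_map_edge].
Qed.
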